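(* Let $\omega\in\mathbb{R}^n$ be non-resonant and suppose that $\omega$ satisfies one of the following two conditions: (i) $\omega\in\mathcal{D}_{\sigma,\tau}$ for some $\sigma>0$ and $\tau\ge n-1$; (ii) $\omega=(\omega_1,\dots,\omega_n)$ with every component $\omega_i$ algebraic. For $\delta\ge 0$ let $V_\delta:\mathbb{T}^n\to\mathbb{R}^n$ be Lipschitz vector fields with $V_0(x)=\omega$ for all $x$, and such that $\sup_{x\in\mathbb{T}^n}|V_\delta(x)-\omega|\le\delta$ for all sufficiently small $\delta\ge0$. Let $L_\delta(x,v)=\frac12|v-V_\delta(x)|^2$ on $T\mathbb{T}^n$. Then there exist constants $l\in(0,1)$, depending only on $n$ and $\omega$, and $C=C(n,\omega)>0$ such that, for all $\delta>0$ sufficiently small, $$W_1(\mathfrak{M}_0,\mathfrak{M}_\delta)\le C\,\delta^{\,l},\qquad W_1(\widetilde{\mathfrak{M}}_0,\widetilde{\mathfrak{M}}_\delta)\le C\,\delta^{\,l},$$ where $\widetilde{\mathfrak{M}}_\delta$ denotes an arbitrary Mather measure of $L_\delta$, $\mathfrak{M}_\delta$ an arbitrary projected Mather measure of $L_\delta$, and $\widetilde{\mathfrak{M}}_0$, $\mathfrak{M}_0$ are the unique Mather measure and projected Mather measure of $L_0$.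
   Context: $\mathbb{T}^n=\mathbb{R}^n/\mathbb{Z}^n$ is the flat torus, $T\mathbb{T}^n=\mathbb{T}^n\times\mathbb{R}^n$ with its Euclidean product distance, and $\pi:T\mathbb{T}^n\to\mathbb{T}^n$ the canonical projection. A vector $\omega\in\mathbb{R}^n$ is non-resonant if $\langle k,\omega\rangle\ne0$ for all $k\in\mathbb{Z}^n\setminus\{0\}$. For $\sigma>0$, $\tau\ge n-1$, $\mathcal{D}_{\sigma,\tau}$ is the set of $\omega\in\mathbb{R}^n$ with $|\langle\omega,k\rangle|\ge\sigma|k|^{-\tau}$ for all $k\in\mathbb{Z}^n\setminus\{0\}$. A real number is algebraic if it is a root of a nonzero polynomial with integer coefficients. A Borel probability measure $\mu$ on $T\mathbb{T}^n$ is closed if $\int|v|\,d\mu<\infty$ and $\int d\phi(x)\cdot v\,d\mu(x,v)=0$ for all $\phi\in C^1(\mathbb{T}^n,\mathbb{R})$. A Mather measure of a Lagrangian $L$ is a closed probability measure minimizing $\int L\,d\mu$ among all closed probability measures. A projected Mather measure is the pushforward $\pi_\#\widetilde\mu$ of a Mather measure $\widetilde\mu$. Under the hypotheses, $L_0$ has a unique Mather measure. $W_1(\mu,\nu)=\inf_{\Pi}\int d(x,y)\,d\Pi(x,y)$ is the 1-Wasserstein distance (infimum over couplings $\Pi$ of $\mu$ and $\nu$), on $\mathbb{T}^n$ or $T\mathbb{T}^n$ respectively. *)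

(* Defs.v *)
From HB Require Import structures.
From mathcomp Require Import all_boot all_order all_algebra.
From mathcomp Require Import all_classical all_reals all_analysis.
From mathcomp Require Import generic_quotient ring_quotient.
Import Order.TTheory GRing.Theory Num.Theory.
Import numFieldNormedType.Exports.

Set Implicit Arguments.
Unset Strict Implicit.
Unset Printing Implicit Defensive.

Local Open Scope classical_set_scope.
Local Open Scope quotient_scope.
Local Open Scope ring_scope.

Definition dotp (R : realType) (n : nat) (u v : 'rV[R]_n) : R :=
  \sum_i u 0 i * v 0 i.

(* The library's norm on row vectors is the sup norm. *)
Definition enorm (R : realType) (n : nat) (v : 'rV[R]_n) : R :=
  Num.sqrt (dotp v v).

Definition int_vec (R : realType) (n : nat) (k : 'rV[int]_n) : 'rV[R]_n :=
  map_mx intr k.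

Definition nonresonant (R : realType) (n : nat) (w : 'rV[R]_n) : Prop :=
  forall k : 'rV[int]_n, k != 0 -> dotp (int_vec R k) w != 0.

Definition diophantine (R : realType) (n : nat) (s t : R) (w : 'rV[R]_n) : Prop :=
  forall k : 'rV[int]_n, k != 0 ->
    s * enorm (int_vec R k) `^ (- t) <= `|dotp w (int_vec R k)|.

Definition algebraic_real (R : realType) (x : R) : Prop :=
  exists2 p : {poly int}, p != 0 & root (map_poly intr p) x.

Definition int_lattice (R : realType) (n : nat) : pred 'rV[R]_n :=
  fun v => v \is a mxOver Num.int.

Lemma int_lattice_zmod_closed (R : realType) (n : nat) :
  zmod_closed (@int_lattice R n).
Proof.
split=> [|u v /mxOverP uZ /mxOverP vZ]; apply/mxOverP=> i j; rewrite !mxE.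
  exact: rpred0.
by apply: rpredB; [exact: uZ | exact: vZ].
Qed.

HB.instance Definition _ (R : realType) (n : nat) :=
  GRing.isZmodClosed.Build 'rV[R]_n (@int_lattice R n)
    (@int_lattice_zmod_closed R n).

(* R^n / Z^n, with the quotient topology. *)
Definition torus_quot (R : realType) (n : nat) :=
  Quotient.quot (GRing.ZmodClosed.clone 'rV[R]_n (@int_lattice R n) _).

Definition torus (R : realType) (n : nat) :=
  quotient_topology (torus_quot R n).

Section torus_instances.
Variables (R : realType) (n : nat).
HB.instance Definition _ := Topological.on (torus R n).
HB.instance Definition _ := Quotient.copy (torus R n) (torus_quot R n).
HB.instance Definition _ := isPointed.Build (torus R n) (\pi_(torus R n) 0).
End torus_instances.

Definition to_torus (R : realType) (n : nat) (a : 'rV[R]_n) : torus R n :=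
  \pi_(torus R n) a.

Lemma to_torus_eqP (R : realType) (n : nat) (a b : 'rV[R]_n) :
  to_torus a = to_torus b <-> exists k : 'rV[int]_n, a - b = int_vec R k.
Proof.
have latE : int_lattice (a - b) = (a == b %[mod torus_quot R n]).
  exact: (Quotient.idealrBE (GRing.ZmodClosed.clone _ (@int_lattice R n) _)).
split=> [abE|[k abk]].
  have /mxOverP abZ : int_lattice (a - b) by rewrite latE; apply/eqP.
  exists (map_mx Num.floor (a - b)); apply/matrixP => i j.
  have := abZ i j; rewrite intrEfloor => /eqP {1}<-.
  by rewrite [RHS]mxE [map_mx _ _ i j]mxE.
suff /eqP : a == b %[mod torus_quot R n] by [].
rewrite -latE abk; apply/mxOverP => i j.
by rewrite mxE; exact: intr_int.
Qed.

(* The flat distance: the least Euclidean distance between representatives. *)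
Definition torus_dist (R : realType) (n : nat) (x y : torus R n) : R :=
  inf [set r | exists a b : 'rV[R]_n,
                 [/\ to_torus a = x, to_torus b = y & r = enorm (a - b)]].

Definition tangent (R : realType) (n : nat) : Type :=
  (torus R n * 'rV[R]_n)%type.

HB.instance Definition _ (R : realType) (n : nat) :=
  Topological.copy (tangent R n) (torus R n * 'rV[R]_n)%type.
HB.instance Definition _ (R : realType) (n : nat) :=
  Pointed.copy (tangent R n) (torus R n * 'rV[R]_n)%type.

Definition tangent_dist (R : realType) (n : nat) (p q : tangent R n) : R :=
  Num.sqrt (torus_dist p.1 q.1 ^+ 2 + enorm (p.2 - q.2) ^+ 2).

Definition borel (T : ptopologicalType) := g_sigma_algebraType (@open T).

Notation borel_probability T R := (probability (borel T) R).

(* C^1 functions on the torus are those with a C^1 lift to R^n; in finite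
   dimension it is enough to ask that the differential be pointwise
   continuous. *)
Definition C1_torus (R : realType) (n : nat) (phi : torus R n -> R) : Prop :=
  let f : 'rV[R]_n -> R := phi \o @to_torus R n in
  (forall a, differentiable f a) /\
  (forall v, continuous (fun a => 'd f a v)).

(* The lift is periodic, so the choice of representative is immaterial. *)
Definition diff_torus (R : realType) (n : nat) (phi : torus R n -> R)
    (x : torus R n) (v : 'rV[R]_n) : R :=
  'd (phi \o @to_torus R n) (repr x) v.

Definition closed_measure (R : realType) (n : nat)
    (M : borel_probability (tangent R n) R) : Prop :=
  (\int[M]_p (enorm p.2)%:E < +oo)%E /\
  forall phi : torus R n -> R, C1_torus phi ->
    (\int[M]_p (diff_torus phi p.1 p.2)%:E = 0)%E.

Definition mather_measure (R : realType) (n : nat) (L : tangent R n -> R)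
    (M : borel_probability (tangent R n) R) : Prop :=
  closed_measure M /\
  forall M' : borel_probability (tangent R n) R, closed_measure M' ->
    (\int[M]_p (L p)%:E <= \int[M']_p (L p)%:E)%E.

Definition projected_mather_measure (R : realType) (n : nat)
    (L : tangent R n -> R) (m : borel_probability (torus R n) R) : Prop :=
  exists2 M : borel_probability (tangent R n) R, mather_measure L M &
    forall A : set (borel (torus R n)), measurable A ->
      m A = pushforward M (fst : borel (tangent R n) -> borel (torus R n)) A.

Definition coupling d (T : measurableType d) (R : realType)
    (mu nu : probability T R) : set (probability (T * T)%type R) :=
  [set P | forall A : set T, measurable A ->
     pushforward P fst A = mu A /\ pushforward P snd A = nu A].

Definition wasserstein1 d (T : measurableType d) (R : realType)
    (mu nu : probability T R) (dist : T -> T -> R) : \bar R :=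
  ereal_inf [set (\int[P]_z (dist z.1 z.2)%:E)%E | P in coupling mu nu].

Definition lipschitz_field (R : realType) (n : nat)
    (V : torus R n -> 'rV[R]_n) : Prop :=
  exists K : R, forall x y, enorm (V x - V y) <= K * torus_dist x y.

Definition lagrangian (R : realType) (n : nat) (V : torus R n -> 'rV[R]_n)
    (p : tangent R n) : R :=
  2^-1 * enorm (p.2 - V p.1) ^+ 2.

(* Main.v *)
From HB Require Import structures.
Require Import Defs.
From mathcomp Require Import all_boot all_order all_algebra perm.
From mathcomp Require Import all_classical all_reals all_analysis.
From mathcomp Require Import measurable_realfun.
From mathcomp Require Import ring lra zify.
Import Order.TTheory GRing.Theory Num.Theory.
Import numFieldNormedType.Exports.

Set Implicit Arguments.
Unset Strict Implicit.
Unset Printing Implicit Defensive.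

Local Open Scope classical_set_scope.
Local Open Scope ring_scope.

(** A Mather measure of L_delta moves almost with the constant velocity w, so
its Fourier coefficients are almost those of Haar measure, and two measures
with close Fourier coefficients can be coupled at small cost.

Velocities.  A loop whose velocity is rational and close to w carries a closed
measure, so the minimal action of L_delta is at most of order delta ^ 2.  Since
|V_delta - w| <= delta, a Mather measure M has int |v - w| dM <= c * delta
(mather_velocity_dev); for delta = 0 it is carried by v = w.

Fourier coefficients.  Testing the closedness of M on a sine wave of frequency
k and writing v = w + (v - w) gives
|<k, w>| * |int cos(2 pi <k, x> - c) dM| <= |k| * int |v - w| dM
(closed_wave_mean).  If |<k, w>| >= s * |k| ^ - m, all coefficients of frequency
k are O(delta * |k| ^ (m + 1)), and those of M_0 vanish.  A nonresonant vector
with algebraic components has this property: up to a fixed factor, <k, w> is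
an eigenvalue of an integer matrix with entries O(|k|), and the lowest nonzero
coefficient of its characteristic polynomial is a nonzero integer
(eigenvalue_lower_bound, algebraic_diophantine).

Coupling.  With N = K + 2, the translates of prod_i cos(pi x_i) ^ (2 K) to the
N ^ n points of the grid of step 1 / N, suitably normalized, form a partition of
unity.  Its members are trigonometric polynomials of degree K, and they are
concentrated within O(K ^ (- 1 / 2)) of their centres (grid_bump_disp).  Haar
measure gives them all the mass N ^ - n, and the projection of M differs from
it by the size E of the low Fourier coefficients, so that the two measures can
be coupled with most of the mass staying under one bump
(wasserstein1_partition_le).  The cost is O(K ^ (- 1 / 2) + N ^ n * E + delta).
For K of order delta ^ (- 1 / (n + m + 2)) this is O(delta ^ l) with
l = 1 / (2 * (n + m + 2)) (scale_choice). *)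

(** * Integration preliminaries and measures with a density *)

Lemma integral_probability_cst d (T : measurableType d) (R : realType)
    (P : probability T R) (r : R) : (\int[P]_x r%:E = r%:E)%E.
Proof.
rewrite integral_cst// [X in (_ * X)%E](_ : _ = 1%E) ?mule1//.
exact: probability_setT.
Qed.

Lemma probability_bounded_integrable d (T : measurableType d) (R : realType)
    (P : probability T R) (f : T -> R) (c : R) :
  measurable_fun setT f -> (forall x, `|f x| <= c) ->
  P.-integrable setT (EFin \o f).
Proof.
move=> mf fc; apply: measurable_bounded_integrable => //.
  by rewrite [X in (X < _)%E](_ : _ = 1%E) ?ltry//; exact: probability_setT.
by exists c; split=> [|r cr x _]; [exact: num_real|exact: le_trans (ltW cr)].
Qed.

Section density.
Context {d : measure_display} {T : measurableType d} {R : realType}.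
Variables (mu : {measure set T -> \bar R}) (h : T -> R).
Hypotheses (mh : measurable_fun setT h) (h_ge0 : forall x, 0 <= h x).

(** The two proofs are arguments so that the measure structure can be attached
to the function. *)
Definition with_density (mh : measurable_fun setT h)
    (h_ge0 : forall x, 0 <= h x) (A : set T) : \bar R :=
  (\int[mu]_(x in A) (h x)%:E)%E.

Let density0 : with_density mh h_ge0 set0 = 0%E.
Proof. by rewrite /with_density integral_set0. Qed.

Let density_ge0 A : (0 <= with_density mh h_ge0 A)%E.
Proof. by apply: integral_ge0 => x _; rewrite lee_fin. Qed.

Let density_sigma_additive : semi_sigma_additive (with_density mh h_ge0).
Proof.
move=> /= F mF tF mUF; rewrite /with_density; apply: cvg_toP.
  apply: ereal_nondecreasing_is_cvgn => m n mn.
  by apply: lee_sum_nneg_natr => // k _ _; exact: density_ge0.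
rewrite ge0_integral_bigcup//=; last 2 first.
- by apply/measurable_EFinP; exact: measurable_funTS.
- by move=> x _; rewrite lee_fin.
Qed.

HB.instance Definition _ := isMeasure.Build _ _ _ (with_density mh h_ge0)
  density0 density_ge0 density_sigma_additive.

Import HBNNSimple.

Lemma integral_with_density_nnsfun (s : {nnsfun T >-> R}) :
  (\int[with_density mh h_ge0]_x (s x)%:E = \int[mu]_x (s x * h x)%:E)%E.
Proof.
under [LHS]eq_integral do rewrite fimfunE -fsumEFin//.
rewrite [LHS]ge0_integral_fsum//; last 2 first.
  - by move=> r; exact/measurable_EFinP/measurableT_comp.
  - by move=> n x _; rewrite EFinM nnfun_muleindic_ge0.
under [RHS]eq_integral.
  move=> x xD; rewrite mulrC EFinM fimfunE -fsumEFin// ge0_mule_fsumr; last first.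
    by move=> r; rewrite EFinM nnfun_muleindic_ge0.
  over.
have mhE : measurable_fun setT (EFin \o h) by exact: measurableT_comp.
rewrite [RHS]ge0_integral_fsum//; last 2 first.
  - move=> r; apply: emeasurable_funM => //.
    exact/measurable_EFinP/measurableT_comp.
  - move=> n x _; rewrite mule_ge0//; last by rewrite nnfun_muleindic_ge0.
    by rewrite lee_fin.
apply: eq_fsbigr => r _.
have mr : measurable (s @^-1` [set r]) by exact: measurable_sfunP.
rewrite (integralZl_indic_nnsfun _ measurableT)//.
rewrite integral_indic// setIT /=.
rewrite -[with_density _ _ _]/(\int[mu]_(x in s @^-1` [set r]) (h x)%:E)%E.
rewrite [in LHS]integral_mkcond.
have [r0|r0] := leP 0 r.
  rewrite -ge0_integralZl//; last 2 first.
  - by apply/(measurable_restrictT _ _).1 => //; exact: measurable_funTS.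
  - by move=> x _; apply: erestrict_ge0 => t _; rewrite lee_fin.
  apply: eq_integral => x _; rewrite patchE indicE.
  by case: ifPn => _; rewrite ?mulr1 ?mulr0 ?mule0 ?EFinM // muleC.
rewrite (_ : s @^-1` [set r] = set0); last first.
  by rewrite preimage_nnfun0.
rewrite (eq_integral (cst 0%E)) => [|x _]; last by rewrite patch_set0.
rewrite integral0 mule0 [RHS](eq_integral (cst 0%E)) => [|x _]; last first.
  by rewrite indicE in_set0 mulr0 mule0.
by rewrite integral0.
Qed.

(** The integral of f is a supremum over the simple functions below f, for which
the density can be moved into the integrand; this also covers integrands that
are not measurable, such as a distance on a product of Borel spaces. *)
Lemma integral_with_density_le (f : T -> R) (g : T -> \bar R) :
  measurable_fun setT g ->
  (forall x, 0 <= f x) -> (forall x, (0 <= g x)%E) ->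
  (forall x, ((f x * h x)%:E <= g x)%E) ->
  (\int[with_density mh h_ge0]_x (f x)%:E <= \int[mu]_x g x)%E.
Proof.
move=> mg f_ge0 g_ge0 fhg.
rewrite [leLHS]ge0_integralTE => [|x]; last by rewrite lee_fin.
apply: ge_ereal_sup => _ [s /= sf <-].
have := integral_nnsfun (with_density mh h_ge0) measurableT s.
rewrite patch_setT => <-.
rewrite integral_with_density_nnsfun; apply: ge0_le_integral => //.
- by move=> x _; rewrite lee_fin mulr_ge0.
- exact/measurable_EFinP/measurable_funM.
- move=> x _; apply: le_trans (fhg x).
  by rewrite lee_fin ler_wpM2r// -lee_fin.
Qed.
End density.

(** * Coupling along a partition of unity *)

Lemma ge0_integral_tensor_sum d (T : measurableType d) (R : realType)
    (nu mu : {sigma_finite_measure set T -> \bar R}) (J : finType)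
    (A B : J -> T -> R) :
  (forall j, measurable_fun setT (A j)) ->
  (forall j, measurable_fun setT (B j)) ->
  (forall j x, 0 <= A j x) -> (forall j x, 0 <= B j x) ->
  (\int[nu \x mu]_z (\sum_j A j z.1 * B j z.2)%:E =
   \sum_j (\int[nu]_x (A j x)%:E) * (\int[mu]_y (B j y)%:E))%E.
Proof.
move=> mA mB A_ge0 B_ge0.
have mAB j : measurable_fun setT (fun z : T * T => A j z.1 * B j z.2).
  by apply: measurable_funM; apply: measurableT_comp.
under eq_integral do rewrite -sumEFin.
rewrite ge0_integral_sum//; last 2 first.
- by move=> j; exact/measurable_EFinP.
- by move=> j z _; rewrite lee_fin mulr_ge0.
apply: eq_bigr => j _; rewrite fubini_tonelli1; last 2 first.
- exact/measurable_EFinP.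
- by move=> z; rewrite lee_fin mulr_ge0.
rewrite /fubini_F muleC -ge0_integralZl//; last 3 first.
- exact/measurable_EFinP.
- by move=> x _; rewrite lee_fin.
- by apply: integral_ge0 => y _; rewrite lee_fin.
apply: eq_integral => x _ /=; rewrite muleC -ge0_integralZl ?lee_fin//.
- exact/measurable_EFinP.
- by move=> y _; rewrite lee_fin.
Qed.

Lemma ge0_integral_linear_sum d (T : measurableType d) (R : realType)
    (mu : {measure set T -> \bar R}) (J : finType) (c : J -> R)
    (A : J -> T -> R) :
  (forall j, measurable_fun setT (A j)) ->
  (forall j x, 0 <= A j x) -> (forall j, 0 <= c j) ->
  (\int[mu]_x (\sum_j c j * A j x)%:E =
   \sum_j (c j)%:E * (\int[mu]_x (A j x)%:E))%E.
Proof.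
move=> mA A_ge0 c_ge0; under eq_integral do rewrite -sumEFin.
have mcA j : measurable_fun setT (fun x => c j * A j x) by exact: measurable_funM.
rewrite ge0_integral_sum//; last 2 first.
- by move=> j; exact/measurable_EFinP.
- by move=> j x _; rewrite lee_fin mulr_ge0.
apply: eq_bigr => j _; under eq_integral do rewrite EFinM.
rewrite ge0_integralZl ?lee_fin//.
- exact/measurable_EFinP.
- by move=> x _; rewrite lee_fin.
Qed.

(** The plan draws x from nu, picks j with probability f j x and draws y with
density k j with respect to mu.  The natural choice f j / b for k j would give
the wrong second marginal.  Damping it by t leaves room for the constant r j,
nonnegative since t * a j <= b, which makes each k j of mass 1 and their
b-weighted sum equal to 1: both marginals are then right. *)
Section coupling.
Context d (T : measurableType d) (R : realType) (nu mu : probability T R).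
Variables (J : finType) (f : J -> T -> R) (a : J -> R) (b t : R).
Hypotheses (mf : forall j, measurable_fun setT (f j))
  (f_ge0 : forall j x, 0 <= f j x) (f_sum : forall x, \sum_j f j x = 1)
  (b_gt0 : 0 < b) (t_ge0 : 0 <= t)
  (int_nu : forall j, (\int[nu]_x (f j x)%:E = b%:E)%E)
  (int_mu : forall j, (\int[mu]_x (f j x)%:E = (a j)%:E)%E)
  (tab : forall j, t * a j <= b).

Let r j : R := 1 - t / b * a j.
Let k j (y : T) := t / b * f j y + r j.
Let h (z : T * T) := \sum_j f j z.1 * k j z.2.

Let tb_ge0 : 0 <= t / b. Proof. by rewrite divr_ge0// ltW. Qed.

Let r_ge0 j : 0 <= r j.
Proof. by rewrite subr_ge0 mulrAC ler_pdivrMr// mul1r. Qed.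

Let k_ge0 j y : 0 <= k j y.
Proof. by rewrite addr_ge0// mulr_ge0. Qed.

Let mk j : measurable_fun setT (k j).
Proof. by apply: measurable_funD => //; exact: measurable_funM. Qed.

Let h_ge0 z : 0 <= h z.
Proof. by apply: sumr_ge0 => j _; exact: mulr_ge0. Qed.

Let mh : measurable_fun setT h.
Proof.
apply: measurable_sum => j.
by apply: measurable_funM; exact: measurableT_comp.
Qed.

Let a_ge0 j : 0 <= a j.
Proof.
by rewrite -lee_fin -int_mu; apply: integral_ge0 => x _; rewrite lee_fin.
Qed.

Let integral_partition (m : probability T R) :
  (\sum_j \int[m]_x (f j x)%:E = 1)%E.
Proof.
rewrite -ge0_integral_sum//; last 2 first.
- by move=> j; exact/measurable_EFinP.
- by move=> j x _; rewrite lee_fin.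
under eq_integral do rewrite sumEFin f_sum.
exact: integral_probability_cst.
Qed.

Let b_sum : \sum_(j : J) b = 1.
Proof.
apply: EFin_inj; rewrite -sumEFin -(integral_partition nu).
by apply: eq_bigr => j _; rewrite int_nu.
Qed.

Let a_sum : \sum_j a j = 1.
Proof.
apply: EFin_inj; rewrite -sumEFin -(integral_partition mu).
by apply: eq_bigr => j _; rewrite int_mu.
Qed.

Let int_k j : (\int[mu]_y (k j y)%:E = 1)%E.
Proof.
under eq_integral do rewrite EFinD EFinM.
have mtf : measurable_fun setT (fun y => t / b * f j y) by exact: measurable_funM.
rewrite ge0_integralD//; last 3 first.
- by move=> y _; rewrite -EFinM lee_fin mulr_ge0.
- exact/measurable_EFinP.
- by move=> y _; rewrite lee_fin.
rewrite ge0_integralZl//; last 2 first.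
- exact/measurable_EFinP.
- by move=> y _; rewrite lee_fin.
rewrite int_mu integral_probability_cst.
by rewrite -EFinM -EFinD /r addrC subrK.
Qed.

Let br_sum : \sum_j b * r j = 1 - t.
Proof.
under eq_bigr do rewrite mulrBr mulr1 mulrA (mulrC b) divfK ?gt_eqF//.
by rewrite sumrB b_sum -mulr_sumr a_sum mulr1.
Qed.

Let bk_sum y : \sum_j b * k j y = 1.
Proof.
under eq_bigr do rewrite mulrDr mulrA (mulrC b (t / b)) divfK ?gt_eqF//.
by rewrite big_split/= br_sum -mulr_sumr f_sum mulr1 addrC subrK.
Qed.

Let integral_fst_density (g : T -> R) : measurable_fun setT g ->
  (forall x, 0 <= g x) ->
  (\int[nu \x mu]_z (g z.1 * h z)%:E = \int[nu]_x (g x)%:E)%E.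
Proof.
move=> mg g_ge0.
rewrite (eq_integral (fun z => (\sum_j (f j z.1 * g z.1) * k j z.2)%:E)).
  rewrite (ge0_integral_tensor_sum nu mu (A := fun j x => f j x * g x))//.
  - under eq_bigr do rewrite int_k mule1.
  rewrite -ge0_integral_sum//; last 2 first.
  - by move=> j; exact/measurable_EFinP/measurable_funM.
  - by move=> j x _; rewrite lee_fin mulr_ge0.
  by apply: eq_integral => x _; rewrite sumEFin -mulr_suml f_sum mul1r.
  - by move=> j; exact: measurable_funM.
  - by move=> j x; exact: mulr_ge0.
move=> z _; congr EFin; rewrite /h mulr_sumr; apply: eq_bigr => j _.
by rewrite mulrA (mulrC (g _)).
Qed.

Let integral_snd_density (g : T -> R) : measurable_fun setT g ->
  (forall x, 0 <= g x) ->
  (\int[nu \x mu]_z (g z.2 * h z)%:E = \int[mu]_y (g y)%:E)%E.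
Proof.
move=> mg g_ge0.
rewrite (eq_integral (fun z => (\sum_j f j z.1 * (k j z.2 * g z.2))%:E)).
  rewrite (ge0_integral_tensor_sum nu mu (B := fun j y => k j y * g y))//.
  - under eq_bigr do rewrite int_nu.
  rewrite -ge0_integral_linear_sum//; last 3 first.
  - by move=> j; exact: measurable_funM.
  - by move=> j x; exact: mulr_ge0.
  - by move=> _; exact: ltW.
  apply: eq_integral => y _; under eq_bigr do rewrite mulrA.
  by rewrite -mulr_suml bk_sum mul1r.
  - by move=> j; exact: measurable_funM.
  - by move=> j x; exact: mulr_ge0.
move=> z _; congr EFin; rewrite /h mulr_sumr; apply: eq_bigr => j _.
by rewrite mulrCA (mulrC (g _)).
Qed.

Let plan_setT : with_density (nu \x mu)%E mh h_ge0 setT = 1%E.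
Proof.
rewrite -[LHS]/(\int[nu \x mu]_z (h z)%:E)%E.
under eq_integral do rewrite -(mul1r (h _)).
rewrite (integral_fst_density (g := cst 1))//.
exact: integral_probability_cst.
Qed.

Let plan : probability (T * T)%type R :=
  HB.pack (with_density (nu \x mu)%E mh h_ge0)
    (Measure_isProbability.Build _ _ _ (with_density (nu \x mu)%E mh h_ge0)
       plan_setT).

Let coupling_plan : coupling nu mu plan.
Proof.
have prep (B : set (T * T)) (A : set T) (g : T * T -> T) :
    (forall z, B z <-> A (g z)) ->
    plan B = (\int[nu \x mu]_z (\1_A (g z) * h z)%:E)%E.
  move=> BA; rewrite -[LHS]/(\int[nu \x mu]_(z in B) (h z)%:E)%E.
  rewrite integral_mkcond; apply: eq_integral => z _.
  rewrite patchE indicE; case: ifPn.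
    by rewrite inE => /BA Ag; rewrite mem_set// mul1r.
  by rewrite notin_setE => nB; rewrite memNset ?mul0r// => /BA.
move=> A mA; split; rewrite /pushforward.
- rewrite (prep _ A fst)// integral_fst_density//.
  by rewrite integral_indic// setIT.
- rewrite (prep _ A snd)// integral_snd_density//.
  by rewrite integral_indic// setIT.
Qed.

(** Think of p j as the distance to the centre of the j-th bump: the plan keeps
both points under one bump, except for a mass 1 - t that travels at most
2 * D.  The function q is a part of the distance that is controlled by the two
marginals alone. *)
Lemma wasserstein1_partition_le (dist : T -> T -> R) (p : J -> T -> R)
    (q : T -> R) (D P : R) :
  (forall j, measurable_fun setT (p j)) -> measurable_fun setT q ->
  (forall j x, 0 <= p j x <= D) -> (forall x, 0 <= q x) ->
  (forall x, \sum_j f j x * p j x <= P) ->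
  (forall x y, 0 <= dist x y) ->
  (forall j x y, dist x y <= p j x + p j y + (q x + q y)) ->
  (wasserstein1 nu mu dist <= (2 * P + 2 * D * (1 - t))%:E +
     (\int[nu]_x (q x)%:E + \int[mu]_x (q x)%:E))%E.
Proof.
move=> mp mq p_bnd q_ge0 sum_le dist_ge0 dist_le.
have p_ge0 j x : 0 <= p j x by case/andP: (p_bnd j x).
have pD j x : p j x <= D by case/andP: (p_bnd j x).
apply: le_trans (_ : \int[plan]_z (dist z.1 z.2)%:E <= _)%E.
  by apply: ereal_inf_lbound; exists plan.
(* The cost density is split into the distances of the two points to the centre
   of their common bump, the mass matched regardless of the bumps, and the
   contributions of q at both ends. *)
pose U1 (z : T * T) := \sum_j (f j z.1 * p j z.1) * (t / b * f j z.2).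
pose U2 (z : T * T) := \sum_j f j z.1 * (t / b * (f j z.2 * p j z.2)).
pose U3 (z : T * T) := \sum_j f j z.1 * (2 * D * r j).
pose U4 (z : T * T) := q z.1 * h z.
pose U5 (z : T * T) := q z.2 * h z.
have D_ge0 (j : J) : 0 <= D.
  by have := p_bnd j point => /andP[]; exact: le_trans.
have mpr (A B : J -> T -> R) : (forall j, measurable_fun setT (A j)) ->
    (forall j, measurable_fun setT (B j)) ->
    measurable_fun setT (fun z : T * T => \sum_j A j z.1 * B j z.2).
  move=> mA mB; apply: measurable_sum => j.
  by apply: measurable_funM; exact: measurableT_comp.
have mfp j : measurable_fun setT (fun x => f j x * p j x) by exact: measurable_funM.
have mU1 : measurable_fun setT U1.
  by apply: (mpr (fun j x => f j x * p j x) (fun j x => t / b * f j x)) => // j;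
    exact: measurable_funM.
have mU2 : measurable_fun setT U2.
  by apply: (mpr f (fun j x => t / b * (f j x * p j x))) => // j;
    exact: measurable_funM.
have mU3 : measurable_fun setT U3.
  by apply: (mpr f (fun j x => 2 * D * r j)) => // j;  exact: measurable_cst.
have mU4 : measurable_fun setT U4.
  by apply: measurable_funM => //; exact: measurableT_comp.
have mU5 : measurable_fun setT U5.
  by apply: measurable_funM => //; exact: measurableT_comp.
have fp_ge0 j x : 0 <= f j x * p j x by exact: mulr_ge0.
have Dr_ge0 j : 0 <= 2 * D * r j by rewrite mulr_ge0 ?mulr_ge0 ?(D_ge0 j).
have tf_ge0 j x : 0 <= t / b * f j x by exact: mulr_ge0.
have tfp_ge0 j x : 0 <= t / b * (f j x * p j x) by exact: mulr_ge0.
have U1_ge0 z : 0 <= U1 z by apply: sumr_ge0 => j _; exact: mulr_ge0.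
have U2_ge0 z : 0 <= U2 z by apply: sumr_ge0 => j _; exact: mulr_ge0.
have U3_ge0 z : 0 <= U3 z by apply: sumr_ge0 => j _; rewrite mulr_ge0.
have U4_ge0 z : 0 <= U4 z by rewrite mulr_ge0.
have U5_ge0 z : 0 <= U5 z by rewrite mulr_ge0.
pose U z := U1 z + U2 z + U3 z + (U4 z + U5 z).
have dist_U z : dist z.1 z.2 * h z <= U z.
  rewrite /U /U4 /U5 -mulrDl /h mulr_sumr mulr_sumr -!big_split/=.
  apply: ler_sum => j _; rewrite /k.
  have r0 := r_ge0 j; have dz := dist_le j z.1 z.2.
  have := pD j z.1; have := pD j z.2.
  move: (f j z.1) (f j z.2) (p j z.1) (p j z.2) (f_ge0 j z.1) (f_ge0 j z.2) dz.
  move=> u v p1 p2 u0 v0 dz p1D p2D.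
  have := tb_ge0; move: (t / b) => c c0; set Q := q z.1 + q z.2.
  have -> : u * p1 * (c * v) + u * (c * (v * p2)) + u * (2 * D * r j) +
      Q * (u * (c * v + r j)) =
    (p1 + p2 + Q) * (u * (c * v)) + (2 * D + Q) * (u * r j) by ring.
  rewrite [u * (_ + _)]mulrDr [dist _ _ * _]mulrDr.
  apply: lerD; apply: ler_wpM2r; rewrite ?mulr_ge0//.
  by apply: (le_trans dz); rewrite -/Q lerD2r mulr_natl mulr2n lerD.
have plan_le : (\int[plan]_z (dist z.1 z.2)%:E <= \int[nu \x mu]_z (U z)%:E)%E.
  apply: integral_with_density_le => //.
  - apply/measurable_EFinP; rewrite /U.
    by do ! apply: measurable_funD => //.
  - by move=> z; rewrite lee_fin !addr_ge0.
apply: (le_trans plan_le).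
have split2 (A B : T * T -> R) : measurable_fun setT A -> measurable_fun setT B ->
    (forall z, 0 <= A z) -> (forall z, 0 <= B z) ->
    (\int[nu \x mu]_z (A z + B z)%:E =
     \int[nu \x mu]_z (A z)%:E + \int[nu \x mu]_z (B z)%:E)%E.
  move=> mA mB A0 B0; under eq_integral do rewrite EFinD.
  rewrite ge0_integralD//.
  - by move=> z _; rewrite lee_fin.
  - exact/measurable_EFinP.
  - by move=> z _; rewrite lee_fin.
  - exact/measurable_EFinP.
have tba_le1 j : t / b * a j <= 1 by rewrite -subr_ge0; exact: r_ge0.
have int_fp (m : probability T R) : (\sum_j \int[m]_x (f j x * p j x)%:E <= P%:E)%E.
  rewrite -ge0_integral_sum//; last 2 first.
  - by move=> j; exact/measurable_EFinP.
  - by move=> j x _; rewrite lee_fin.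
  apply: (@le_trans _ _ (\int[m]_x P%:E)%E).
    apply: ge0_le_integral => //.
    - by move=> x _; apply: sume_ge0 => j _; rewrite lee_fin.
    - by apply: emeasurable_sum => j; exact/measurable_EFinP.
    - by move=> x _; rewrite sumEFin lee_fin.
  by rewrite integral_probability_cst.
have int_U1 : (\int[nu \x mu]_z (U1 z)%:E <= P%:E)%E.
  rewrite (ge0_integral_tensor_sum nu mu (A := fun j x => f j x * p j x)
    (B := fun j y => t / b * f j y))//.
  - apply: le_trans (int_fp nu); apply: lee_sum => j _.
    under [X in (_ * X)%E]eq_integral do rewrite EFinM.
    rewrite ge0_integralZl//; last 2 first.
    + exact/measurable_EFinP.
    + by move=> y _; rewrite lee_fin.
    rewrite int_mu -EFinM -[leRHS]mule1 lee_wpmul2l ?lee_fin//.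
    by apply: integral_ge0 => x _; rewrite lee_fin.
  - by move=> j; exact: measurable_funM.
have t_le1 : t <= 1.
  by rewrite -subr_ge0 -br_sum sumr_ge0// => j _; rewrite mulr_ge0// ltW.
have int_U2 : (\int[nu \x mu]_z (U2 z)%:E <= P%:E)%E.
  rewrite (ge0_integral_tensor_sum nu mu
    (B := fun j y => t / b * (f j y * p j y)))//.
  - apply: le_trans (int_fp mu); apply: lee_sum => j _.
    under [X in (_ * X)%E]eq_integral do rewrite EFinM.
    rewrite ge0_integralZl//; last 2 first.
    + exact/measurable_EFinP.
    + by move=> y _; rewrite lee_fin.
    rewrite int_nu muleA -EFinM -[leRHS]mul1e lee_wpmul2r ?lee_fin//.
      by apply: integral_ge0 => x _; rewrite lee_fin.
    by rewrite mulrC divfK ?gt_eqF.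
  - by move=> j; exact: measurable_funM.
have int_U3 : (\int[nu \x mu]_z (U3 z)%:E = (2 * D * (1 - t))%:E)%E.
  rewrite (ge0_integral_tensor_sum nu mu (B := fun j y => 2 * D * r j))//.
  rewrite -br_sum mulr_sumr -sumEFin; apply: eq_bigr => j _.
  by rewrite int_nu integral_probability_cst -EFinM mulrCA.
rewrite /U split2//; last 4 first.
- by apply: measurable_funD => //; exact: measurable_funD.
- exact: measurable_funD.
- by move=> z; rewrite !addr_ge0.
- by move=> z; rewrite !addr_ge0.
rewrite split2//; last 2 first.
- exact: measurable_funD.
- by move=> z; rewrite !addr_ge0.
rewrite split2// (split2 U4)// int_U3 integral_fst_density// integral_snd_density//.
apply: leeD => //; rewrite EFinD; apply: leeD => //.
have -> : 2 * P = P + P by ring.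
by rewrite EFinD; exact: leeD.
Qed.
End coupling.

(** * Liouville's inequality for linear forms in algebraic numbers *)

(** Coefficientwise domination passes to products since the coefficients of a
product are sums of products of coefficients. *)
Lemma coef_prod_majorant (I : finType) (F G : I -> {poly int}) :
  (forall i k, `|(F i)`_k| <= (G i)`_k) ->
  forall k, `|(\prod_i F i)`_k| <= (\prod_i G i)`_k.
Proof.
move=> FG; elim/big_ind2: _ => [k|p p' q q' pp qq k|i _]; last exact: FG.
  by rewrite coef1 ger0_norm ?ler0n.
rewrite !coefM; apply: le_trans (ler_norm_sum _ _ _) _; apply: ler_sum => j _.
by rewrite normrM; apply: ler_pM.
Qed.

Lemma coef_le_horner1 (p : {poly int}) k :
  (forall j, 0 <= p`_j) -> p`_k <= p.[1].
Proof.
move=> p_ge0; rewrite horner_coef; have [kp|pk] := ltnP k (size p).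
  rewrite (bigD1 (Ordinal kp))//= expr1n mulr1 lerDl sumr_ge0// => i _.
  by rewrite expr1n mulr1.
by rewrite nth_default// sumr_ge0// => i _; rewrite expr1n mulr1.
Qed.

(** Every entry of the characteristic matrix is dominated by B * ('X + 1), so
each of the N! terms of its determinant is dominated by the N-th power of that
polynomial, and its value at 1 bounds its coefficients. *)
Lemma coef_char_poly_le (N : nat) (A : 'M[int]_N) (B : int) : 1 <= B ->
  (forall i j, `|A i j| <= B) ->
  forall k, `|(char_poly A)`_k| <= N`!%:R * (2 * B) ^+ N.
Proof.
move=> B_ge1 A_le k.
have B_ge0 : 0 <= B by exact: le_trans B_ge1.
pose G : {poly int} := B *: ('X + 1).
have GE m : G`_m = B * ((m == 1)%N + (m == 0)%N)%:R.
  by rewrite coefZ coefD coefX coef1 natrD.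
have entry_le i j m : `|(char_poly_mx A i j)`_m| <= G`_m.
  rewrite !mxE coefB coefC coefMn coefX GE.
  case: m => [|[|m]] /=; rewrite ?mul0rn ?subr0 ?mulr0 ?normr0//.
  - by rewrite sub0r normrN mulr1.
  - by rewrite mulr1; case: (i == j); rewrite ?mulr1n ?mulr0n ?normr1 ?normr0.
have G1 : (\prod_(i < N) G).[1] = (2 * B) ^+ N.
  rewrite prodr_const card_ord horner_exp hornerZ hornerD hornerX hornerC.
  by rewrite mulrC.
rewrite /char_poly /determinant coef_sum.
apply: le_trans (ler_norm_sum _ _ _) _.
have -> : N`!%:R * (2 * B) ^+ N = \sum_(s : {perm 'I_N}) (2 * B) ^+ N.
  by rewrite sumr_const (eq_card (B := 'S_N)) ?card_Sn ?mulr_natl// => s; rewrite inE.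
apply: ler_sum => s _.
rewrite mulr_sign -G1 (_ : `|_`_k| = `|(\prod_i char_poly_mx A i (s i))`_k|); last first.
  by case: ifP; rewrite ?coefN ?normrN.
apply: (le_trans (coef_prod_majorant (G := fun=> G) _ k)) => //.
apply: coef_le_horner1 => j.
apply: le_trans (normr_ge0 _)
  (coef_prod_majorant (F := fun _ : 'I_N => G) (G := fun=> G) _ j) => i m.
by rewrite ger0_norm// GE mulr_ge0.
Qed.

(** A nonzero eigenvalue of an integer matrix cannot be small: the lowest nonzero
coefficient of the characteristic polynomial is a nonzero integer, and it is
balanced by terms containing at least one more power of the eigenvalue. *)
Lemma eigenvalue_lower_bound (R : realType) (N : nat) (A : 'M[int]_N) (B : int)
    (u : 'rV[R]_N) (x : R) : 1 <= B -> (forall i j, `|A i j| <= B) ->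
  u *m map_mx intr A = x *: u -> u != 0 -> x != 0 -> `|x| <= 1 ->
  1 <= (N.+1 * N`!)%:R * (2 * B%:~R) ^+ N * `|x|.
Proof.
move=> B_ge1 A_le uA u0 x0 x_le1.
set p := char_poly A; set H : int := N`!%:R * (2 * B) ^+ N.
have pH k : `|p`_k| <= H by exact: coef_char_poly_le.
have px0 : \sum_(i < N.+1) (p`_i)%:~R * x ^+ i = 0.
  have : eigenvalue (map_mx intr A) x by apply/eigenvalueP; exists u.
  rewrite eigenvalue_root_char -map_char_poly /root horner_coef => /eqP.
  rewrite size_map_inj_poly// ?size_char_poly; last exact: intr_inj.
  by move=> px; rewrite -[RHS]px; apply: eq_bigr => i _; rewrite coef_map.
have ex_m : exists m, p`_m != 0.
  exists N; have /monicP := char_poly_monic A.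
  by rewrite lead_coefE size_char_poly => ->.
have [m pm0 min_m] := ex_minnP ex_m.
have mN : (m < N.+1)%N.
  apply: min_m; have /monicP := char_poly_monic A.
  by rewrite lead_coefE size_char_poly => ->.
have xm0 : 0 < `|x| ^+ m by rewrite exprn_gt0 ?normr_gt0.
have pm1 : 1 <= `|(p`_m)%:~R : R|.
  by rewrite -intr_norm -[1]/(1%:~R) ler_int; move: pm0; case: (p`_m) => [[]|].
rewrite -(ler_pM2l xm0) mulr1; apply: le_trans (_ : `|(p`_m)%:~R * x ^+ m| <= _).
  by rewrite normrM normrX ler_peMl// ltW.
move: px0; rewrite (bigD1 (Ordinal mN))//= => /eqP; rewrite addr_eq0 => /eqP ->.
rewrite normrN; apply: le_trans (ler_norm_sum _ _ _) _.
have bnd (i : 'I_N.+1) : i != Ordinal mN ->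
    `|(p`_i)%:~R * x ^+ i| <= H%:~R * `|x| ^+ m.+1.
  move=> im; rewrite normrM normrX -intr_norm.
  have [mi|im'] := ltnP m i.
    apply: ler_pM => //; first by rewrite ler_int pH.
    by rewrite ler_wiXn2l.
  have -> : p`_i = 0.
    apply/eqP; apply: contraNT im => /min_m mi.
    by apply/eqP/val_inj/eqP; rewrite /= eqn_leq im' mi.
  rewrite normr0 mul0r mulr_ge0// ?exprn_ge0// ler0z.
  by apply: le_trans (pH 0%N).
apply: le_trans (ler_sum _ bnd) _.
have HR : H%:~R = N`!%:R * (2 * B%:~R) ^+ N :> R.
  by rewrite /H rmorphM rmorphXn rmorphM /= !rmorph_nat.
have HR0 : 0 <= N`!%:R * (2 * B%:~R) ^+ N :> R.
  rewrite mulr_ge0 ?ler0n// exprn_ge0// mulr_ge0// ler0z.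
  exact: le_trans B_ge1.
rewrite sumr_const -[leLHS]mulr_natr HR exprS natrM -(mulrA N.+1%:R).
move: HR0.
move: (N`!%:R * _) => h h0.
have -> : `|x| ^+ m * (N.+1%:R * h * `|x|) = h * (`|x| * `|x| ^+ m) * N.+1%:R by ring.
by apply: ler_wpM2l; rewrite ?mulr_ge0 ?exprn_ge0// ler_nat -[leqRHS]card_ord max_card.
Qed.

(** Factors 'X equalize the degrees, so that one box of exponents serves all
components. *)
Lemma algebraic_common_degree (R : realType) (n : nat) (w : 'rV[R]_n) :
  (forall i, algebraic_real (w 0 i)) ->
  exists d (q : 'I_n -> {poly int}), forall i,
    size (q i) = d.+2 /\ root (map_poly intr (q i)) (w 0 i).
Proof.
move=> walg; have /choice[p pP] : forall i, exists p : {poly int},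
    p != 0 /\ root (map_poly intr p) (w 0 i).
  by move=> i; have [p p0 pr] := walg i; exists p.
pose s := (\sum_i size (p i))%N.
exists s, (fun i => p i * 'X^(s.+2 - size (p i))) => i; have [p0 pr] := pP i.
have ps : (size (p i) <= s)%N by rewrite /s (bigD1 i)//= leq_addr.
split; first by rewrite size_mulXn// subnK// (leq_trans ps)// -addn2 leq_addr.
by rewrite rmorphM /= rootM pr.
Qed.

(** The monomials in the components of w with bounded exponents span a space
stable under multiplication by each component; up to a common integer factor
this multiplication has an integer matrix. *)

Lemma algebraic_integer_matrices (R : realType) (n : nat) (w : 'rV[R]_n) :
  (forall i, algebraic_real (w 0 i)) ->
  exists N (u : 'rV[R]_N) (D : int) (A : 'I_n -> 'M[int]_N),
    [/\ u != 0, D != 0 & forall i,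
       u *m map_mx intr (A i) = (D%:~R * w 0 i) *: u].
Proof.
move=> /algebraic_common_degree[d [q qP]].
pose I := {ffun 'I_n -> 'I_d.+1}.
pose mono (al : I) : R := \prod_k w 0 k ^+ al k.
pose upd (al : I) i j : I := [ffun k => if k == i then j else al k].
have updE al i j : mono (upd al i j) = w 0 i ^+ j * \prod_(k | k != i) w 0 k ^+ al k.
  rewrite /mono (bigD1 i)//= ffunE eqxx; congr (_ * _).
  by apply: eq_bigr => k /negPf ki; rewrite ffunE ki.
pose l i : int := (q i)`_d.+1.
have l0 i : l i != 0.
  have [sq _] := qP i; rewrite /l -[d.+1]/(d.+2.-1) -sq -lead_coefE lead_coef_eq0.
  by rewrite -size_poly_eq0 sq.
have row_ex (z : 'I_n * I) : exists c : I -> int,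
    (l z.1)%:~R * w 0 z.1 * mono z.2 = \sum_be mono be * (c be)%:~R.
  case: z => i al /=.
  have monoE : mono al = w 0 i ^+ al i * \prod_(k | k != i) w 0 k ^+ al k.
    by rewrite /mono (bigD1 i).
  have one (be : I) (c : int) : mono be * c%:~R =
      \sum_ga mono ga * (if ga == be then c else 0)%:~R.
    rewrite (bigD1 be)//= eqxx big1 ?addr0// => ga /negPf ->.
    by rewrite mulr0.
  (* Multiplying a monomial by w i raises its i-th exponent; from the top
     exponent d the equation of w i leads back into the box. *)
  have [ald|dal] := ltnP (al i) d.
    exists (fun ga => if ga == upd al i (inord (al i).+1) then l i else 0).
    rewrite -one updE inordK ?ltnS// monoE exprS; ring.
  have ald : al i = d :> nat by apply/eqP; rewrite eqn_leq dal -ltnS ltn_ord.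
  exists (fun ga => \sum_(j < d.+1) if ga == upd al i j then - (q i)`_j else 0).
  under eq_bigr do rewrite rmorph_sum mulr_sumr.
  rewrite exchange_big /=; under eq_bigr do rewrite -one updE.
  have [sq] := qP i; rewrite /root horner_coef size_map_inj_poly//; last exact: intr_inj.
  rewrite sq big_ord_recr/= => /eqP qw.
  rewrite monoE ald; set P := \prod_(k | _) _.
  have -> : (l i)%:~R * w 0 i * (w 0 i ^+ d * P) = (l i)%:~R * w 0 i ^+ d.+1 * P.
    by rewrite exprS; ring.
  move/eqP: qw; rewrite addrC addr_eq0 coef_map/= => /eqP ->.
  rewrite mulNr mulr_suml -sumrN; apply: eq_bigr => j _.
  by rewrite coef_map/= rmorphN/=; ring.
(* The product of all leading coefficients serves as common factor D. *)
have [c cP] := choice row_ex.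
pose N := #|{: I}|.
exists N, (\row_j mono (enum_val j)), (\prod_i l i),
  (fun i => \matrix_(r, s) ((\prod_(k | k != i) l k) * c (i, enum_val s) (enum_val r))).
split.
- pose al0 : I := [ffun=> ord0].
  apply/eqP => /rowP/(_ (enum_rank al0)); rewrite !mxE enum_rankK /mono.
  by under eq_bigr do rewrite ffunE expr0; rewrite big1// => /eqP; rewrite oner_eq0.
- by apply/prodf_neq0 => i _.
move=> i; apply/rowP => s; rewrite !mxE.
have := cP (i, enum_val s); rewrite (big_enum_val (A := {: I}))/= => cE.
have -> : (\prod_k l k)%:~R = (l i)%:~R * (\prod_(k | k != i) l k)%:~R :> R.
  by rewrite (bigD1 i)//= rmorphM.
set P := (\prod_(k | _) _)%:~R.
have -> : (l i)%:~R * P * w 0 i * mono (enum_val s) =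
    P * ((l i)%:~R * w 0 i * mono (enum_val s)) by ring.
rewrite cE mulr_sumr; apply: eq_bigr => r _.
by rewrite !mxE rmorphM/= -/P mulrCA.
Qed.

Lemma intr_norm_ge1 (R : realType) (z : int) : z != 0 -> 1 <= `|z%:~R : R|.
Proof.
by move=> z0; rewrite -intr_norm -[1]/(1%:~R) ler_int; move: z0; case: z => [[]|].
Qed.

Lemma enorm_ge0 (R : realType) n (v : 'rV[R]_n) : 0 <= enorm v.
Proof. exact: sqrtr_ge0. Qed.

Lemma dotp_ge0 (R : realType) n (v : 'rV[R]_n) : 0 <= dotp v v.
Proof. by apply: sumr_ge0 => i _; rewrite -expr2 sqr_ge0. Qed.

Lemma coord_le_enorm (R : realType) n (v : 'rV[R]_n) i : `|v 0 i| <= enorm v.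
Proof.
rewrite -sqrtr_sqr ler_sqrt ?dotp_ge0// /dotp (bigD1 i)//= expr2 lerDl.
by apply: sumr_ge0 => j _; rewrite -expr2 sqr_ge0.
Qed.

Lemma enorm_int_vec_ge1 (R : realType) n (k : 'rV[int]_n) : k != 0 ->
  1 <= enorm (int_vec R k).
Proof.
move=> k0; have [i ki] : exists i, k 0 i != 0.
  apply/existsP; apply: contraNT k0 => /existsPn k0; apply/eqP/rowP => i.
  by rewrite mxE; apply/eqP; move: (k0 i); rewrite negbK.
by apply: le_trans (coord_le_enorm _ i); rewrite mxE intr_norm_ge1.
Qed.

Lemma dotpC (R : realType) n (u v : 'rV[R]_n) : dotp u v = dotp v u.
Proof. by apply: eq_bigr => i _; rewrite mulrC. Qed.

(** For fixed w the matrices A i are fixed, D * <k, w> is an eigenvalue of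
sum_i k i * A i, and the entries of this matrix are at most c * sum_i |k i|. *)
Lemma algebraic_diophantine (R : realType) n (w : 'rV[R]_n) :
  nonresonant w -> (forall i, algebraic_real (w 0 i)) ->
  exists s N, 0 < s /\ forall k : 'rV[int]_n, k != 0 ->
    s <= enorm (int_vec R k) ^+ N * `|dotp w (int_vec R k)|.
Proof.
move=> wnr /algebraic_integer_matrices[N [u [D [A [u0 D0 uA]]]]].
pose c : int := 1 + \sum_i \sum_r \sum_s `|A i r s|.
have Ac i r s : `|A i r s| <= c.
  have one (J : finType) (F : J -> int) j : (forall j, 0 <= F j) -> F j <= \sum_j F j.
    by move=> F0; rewrite (bigD1 j)//= lerDl sumr_ge0.
  rewrite /c ler_wpDl//; apply: le_trans (one _ _ i _); last first.
    by move=> j; apply: sumr_ge0 => ? _; apply: sumr_ge0.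
  apply: le_trans (one _ _ r _); last by move=> j; apply: sumr_ge0.
  exact: (one _ (fun s => `|A i r s|)).
have c_ge1 : 1 <= c.
  by rewrite lerDl; do 3 (apply: sumr_ge0 => ? _).
pose C : R := 2 * (c%:~R * n%:R).
pose G : R := (N.+1 * N`!)%:R * C ^+ N.
exists (`|D%:~R|^-1 * (1 + G)^-1), N.
have G_ge0 : 0 <= G.
  rewrite mulr_ge0// exprn_ge0// mulr_ge0// mulr_ge0// ler0z.
  exact: le_trans c_ge1.
have DR : 0 < `|D%:~R : R| by rewrite normr_gt0 intr_eq0.
split=> [|k k0]; first by rewrite mulr_gt0 ?invr_gt0 ?ltr_pwDl.
set lam := dotp w _; set e := enorm _.
have e_ge1 : 1 <= e by exact: enorm_int_vec_ge1.
have lam0 : lam != 0 by rewrite /lam dotpC wnr.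
rewrite -(ler_pM2l DR) mulVKf ?gt_eqF//.
pose x := D%:~R * lam.
have x0 : x != 0 by rewrite mulf_neq0 ?intr_eq0.
rewrite mulrCA -normrM -/x -[leLHS]mulr1 ler_pdivrMl//; last by rewrite ltr_pwDl.
have [x_le1|x_gt1] := leP `|x| 1; last first.
  rewrite -[leLHS]mulr1; apply: ler_pM => //.
    by rewrite lerDl.
  rewrite -[leLHS]mulr1; apply: ler_pM => //; last exact: ltW.
  exact: exprn_ege1.
pose M : 'M[int]_N := \sum_i k 0 i *: A i.
pose B : int := c * \sum_i `|k 0 i|.
have k_sum1 : 1 <= \sum_i `|k 0 i|.
  rewrite -gtz0_ge1 lt_def sumr_ge0// andbT; apply: contra k0 => /eqP ks0.
  apply/eqP/rowP => i; rewrite mxE; apply/eqP; rewrite -normr_eq0.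
  have := ks0 => /eqP; rewrite psumr_eq0// => /allP/(_ i (mem_index_enum _)).
  by rewrite implyTb.
have uM : u *m map_mx intr M = x *: u.
  rewrite /M raddf_sum/= mulmx_sumr /x /lam /dotp mulr_sumr scaler_suml.
  apply: eq_bigr => i _; rewrite map_mxZ -scalemxAr uA scalerA mxE.
  by congr (_ *: _); ring.
have ML r s : `|M r s| <= B.
  rewrite /M summxE /B mulr_sumr; apply: le_trans (ler_norm_sum _ _ _) _.
  by apply: ler_sum => i _; rewrite mxE normrM mulrC ler_wpM2r.
have B_ge1 : 1 <= B.
  by rewrite /B -[leLHS]mulr1; apply: ler_pM.
have := eigenvalue_lower_bound B_ge1 ML uM u0 x0 x_le1.
move=> /le_trans; apply; rewrite mulrA ler_wpM2r// (le_trans (_ : _ <= G * e ^+ N))//.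
  rewrite /G -mulrA -exprMn ler_wpM2l// lerXn2r ?nnegrE//.
  - by rewrite mulr_ge0// ler0z (le_trans _ B_ge1).
  - by rewrite !mulr_ge0// ?ler0z ?(le_trans _ c_ge1)// (le_trans _ e_ge1).
  rewrite /C -!mulrA ler_wpM2l// /B rmorphM/= ler_wpM2l ?ler0z ?(le_trans _ c_ge1)//.
  have -> : n%:R * e = \sum_(i < n) e by rewrite sumr_const card_ord mulr_natl.
  rewrite rmorph_sum/=; apply: ler_sum => i _.
  by rewrite intr_norm; have := coord_le_enorm (int_vec R k) i; rewrite mxE.
by rewrite ler_wpM2r ?exprn_ge0 ?(le_trans _ e_ge1)// lerDr.
Qed.

(** * Cosine kernels and their samples *)

Section trig.
Context {R : realType}.
Implicit Types (x u : R).

Lemma cosD2pi_int u (m : int) : cos (u + 2 * pi * m%:~R) = cos u.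
Proof.
have nat_case (v : R) (k : nat) : cos (v + 2 * pi * k%:R) = cos v.
  have -> : v + 2 * pi * k%:R = v + (pi *+ 2) *+ k :> R by ring.
  by rewrite periodicn//; exact: cosD2pi.
case: m => k; first exact: nat_case.
rewrite -(nat_case _ k.+1); congr cos; rewrite NegzE mulrNz.
by rewrite -[k.+1%:~R]/(k.+1%:R); ring.
Qed.

Lemma cos2E u : cos u ^+ 2 = (1 + cos (2 * u)) / 2.
Proof.
by rewrite mulr_natl cos_mulr2n addrCA subrr addr0 -mulr_natr mulfK ?pnatr_eq0.
Qed.

Lemma cos2pi_int x (m : int) : cos (pi * (x + m%:~R)) ^+ 2 = cos (pi * x) ^+ 2.
Proof. by rewrite !cos2E mulrDr mulrDr !mulrA cosD2pi_int. Qed.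

Lemma norm_sinpi_int x (m : int) : `|sin (pi * (x + m%:~R))| = `|sin (pi * x)|.
Proof.
apply/eqP; rewrite -(eqrXn2 (n := 2))// !real_normK ?num_real// !sin2cos2.
by rewrite cos2pi_int.
Qed.

(** Equidistant samples of a nonconstant character of the circle cancel:
multiplied by the sine of half a step, the sum telescopes over a full
period. *)
Lemma sum_cos_equidistant (N : nat) (k : int) u : (`|k| < N)%N -> k != 0 ->
  \sum_(j < N) cos (u - 2 * pi * k%:~R * (j%:R / N%:R)) = 0.
Proof.
move=> kN k0; have N0 : N%:R != 0 :> R.
  by rewrite pnatr_eq0 -lt0n (leq_ltn_trans _ kN).
pose al : R := pi * k%:~R / N%:R.
have sal : sin al != 0.
  have N_gt0 : 0 < N%:R :> R by rewrite lt_def N0 ler0n.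
  have alN : `|al| = pi * `|k|%N%:R / N%:R.
    rewrite /al !normrM ger0_norm ?pi_ge0// [`|N%:R^-1|]ger0_norm ?invr_ge0//.
    by rewrite -intr_norm.
  have : 0 < sin `|al|.
    apply: sin_gt0_pi; rewrite alN; apply/andP; split.
      by rewrite divr_gt0// mulr_gt0 ?pi_gt0// ltr0n absz_gt0.
    rewrite ltr_pdivrMr// ltr_pM2l ?pi_gt0// ltr_nat//.
  have [al0|al0] := ger0P al; first by move/gt_eqF ->.
  by rewrite sinN oppr_gt0 => /lt_eqF ->.
apply: (mulfI sal); rewrite mulr0 mulr_sumr.
pose F j : R := sin (u + al - 2 * al * j%:R) / 2.
transitivity (\sum_(0 <= j < N) (F j - F j.+1)).
  rewrite big_mkord; apply: eq_bigr => j _; rewrite /F.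
  have -> : 2 * pi * k%:~R * (j%:R / N%:R) = 2 * al * j%:R :> R.
    by rewrite /al; field.
  have -> : u + al - 2 * al * j%:R = (u - 2 * al * j%:R) + al by ring.
  have -> : u + al - 2 * al * j.+1%:R = (u - 2 * al * j%:R) - al.
    by rewrite -natr1; ring.
  by move: (u - _) => b; rewrite sinD sinB; field.
transitivity (- (F N - F 0%N)).
  by rewrite -telescope_sumr// -sumrN; apply: eq_bigr => j _; rewrite opprB.
rewrite /F mulr0 subr0 -!cosBpihalf.
have -> : u + al - 2 * al * N%:R - pi / 2 = (u + al - pi / 2) + 2 * pi * (- k)%:~R.
  by rewrite /al mulrNz; field.
by rewrite cosD2pi_int subrr oppr0.
Qed.

(** The Fourier expansion is recorded without its uniqueness.  Nonnegative
coefficients have a sum that can be read off at 0, with no cancellation to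
control. *)
Definition cos_combination n (m : nat) (f : 'rV[R]_n -> R) :=
  exists s : seq (R * 'rV[int]_n),
    [/\ forall y, f y = \sum_(z <- s) z.1 * cos (2 * pi * dotp (int_vec R z.2) y),
        forall z, z \in s -> 0 <= z.1 &
        forall z, z \in s -> \sum_i `|z.2 0 i| <= m%:Z].

Lemma dotpDl n (a b v : 'rV[R]_n) : dotp (a + b) v = dotp a v + dotp b v.
Proof. by rewrite /dotp -big_split; apply: eq_bigr => i _; rewrite mxE mulrDl. Qed.

Lemma dotpNl n (a v : 'rV[R]_n) : dotp (- a) v = - dotp a v.
Proof. by rewrite /dotp -sumrN; apply: eq_bigr => i _; rewrite mxE mulNr. Qed.

Lemma int_vecD n (a b : 'rV[int]_n) : int_vec R (a + b) = int_vec R a + int_vec R b.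
Proof. exact: raddfD. Qed.

Lemma int_vecN n (a : 'rV[int]_n) : int_vec R (- a) = - int_vec R a.
Proof. exact: raddfN. Qed.

Lemma dotp_int_delta n (i : 'I_n) (y : 'rV[R]_n) :
  dotp (int_vec R (delta_mx 0 i)) y = y 0 i.
Proof.
rewrite /dotp (bigD1 i)//= !mxE !eqxx mul1r big1 ?addr0// => j /negPf ji.
by rewrite !mxE eqxx ji mul0r.
Qed.

Lemma cos_combination1 n : cos_combination 0 (fun _ : 'rV[R]_n => 1).
Proof.
exists [:: (1, 0)]; split=> [y|z|z].
- rewrite big_seq1 /= mul1r [int_vec _ _]raddf0.
  by rewrite /dotp big1 ?mulr0 ?cos0// => i _; rewrite mxE mul0r.
- by rewrite inE => /eqP ->.
- by rewrite inE => /eqP -> /=; rewrite big1// => i _; rewrite mxE.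
Qed.

(** The squared cosine is 1 / 2 plus half a cosine wave, so every frequency k
splits into k, k + e_i and k - e_i. *)
Lemma cos_combinationM n m (f : 'rV[R]_n -> R) i : cos_combination m f ->
  cos_combination m.+1 (fun y => f y * cos (pi * y 0 i) ^+ 2).
Proof.
move=> [s [fE s_ge0 s_le]].
pose e : 'rV[int]_n := delta_mx 0 i.
exists (flatten [seq [:: (z.1 / 2, z.2); (z.1 / 4, z.2 + e); (z.1 / 4, z.2 - e)] | z <- s]).
split=> [y|z|z].
- rewrite fE mulr_suml big_flatten big_map; apply: eq_bigr => z _.
  rewrite !big_cons big_nil /= !int_vecD int_vecN !dotpDl dotpNl dotp_int_delta.
  rewrite cos2E (mulrA 2 pi); set t := dotp _ y.
  have -> : 2 * pi * (t + y 0 i) = 2 * pi * t + 2 * pi * y 0 i by ring.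
  have -> : 2 * pi * (t - y 0 i) = 2 * pi * t - 2 * pi * y 0 i by ring.
  by rewrite cosD cosB; field.
- move=> /flattenP[_ /mapP[z' /s_ge0 z0 ->]]; rewrite !inE.
  by move=> /or3P[] /eqP -> /=; rewrite divr_ge0.
have e1 : \sum_j `|e 0 j| = 1.
  rewrite (bigD1 i)//= mxE !eqxx big1 ?addr0// => j /negPf ji.
  by rewrite mxE ji.
move=> /flattenP[_ /mapP[z' /s_le z0 ->]]; rewrite !inE.
have -> : m.+1%:Z = m%:Z + \sum_j `|e 0 j| by rewrite e1 -PoszD addn1.
move=> /or3P[] /eqP -> /=.
- by rewrite (le_trans z0)// lerDl e1.
- apply: le_trans (lerD z0 (lexx _)); rewrite -big_split; apply: ler_sum => j _.
  by rewrite mxE ler_normD.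
- apply: le_trans (lerD z0 (lexx _)); rewrite -big_split; apply: ler_sum => j _.
  by rewrite mxE [(- e) 0 j]mxE ler_normB.
Qed.

Definition bump n (K : nat) (y : 'rV[R]_n) := \prod_i cos (pi * y 0 i) ^+ (2 * K).

Lemma cos_combination_bump n K : cos_combination (n * K) (@bump n K).
Proof.
have power m (f : 'rV[R]_n -> R) i L : cos_combination m f ->
    cos_combination (m + L) (fun y => f y * cos (pi * y 0 i) ^+ (2 * L)).
  move=> fm; elim: L => [|L IH].
    rewrite addn0; congr cos_combination : fm; apply/funext => y.
    by rewrite muln0 expr0 mulr1.
  have := cos_combinationM i IH; rewrite addnS; congr cos_combination.
  by apply/funext => y; rewrite mulnS addnC exprD mulrA.
have all_i (r : seq 'I_n) : cos_combination (size r * K)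
    (fun y => \prod_(i <- r) cos (pi * y 0 i) ^+ (2 * K)).
  elim: r => [|i r IH].
    have := cos_combination1 n; congr cos_combination.
    by apply/funext => y; rewrite big_nil.
  have := power _ _ i K IH; rewrite mulSn addnC; congr cos_combination.
  by apply/funext => y; rewrite big_cons mulrC.
have := all_i (enum 'I_n); rewrite size_enum_ord; congr cos_combination.
by apply/funext => y; rewrite big_enum.
Qed.
End trig.

Section sampling.
Context {R : realType} (N : nat).
Implicit Types (t : R).

Definition cos_sample (K : nat) t :=
  \sum_(j < N) cos (t - pi * (j%:R / N%:R)) ^+ (2 * K).

(** The K-th power of a squared cosine has frequencies at most K < N, and
sampling at N equidistant points kills all of them but 0. *)
Lemma cos_sample_const K t : (K < N)%N -> cos_sample K t = cos_sample K 0.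
Proof.
move=> KN; have [s [fE _ s_le]] := @cos_combination_bump R 1 K.
suff E u : cos_sample K u = \sum_(z <- s) z.1 * (if z.2 == 0 then N%:R else 0).
  by rewrite !E.
have pi0 : pi != 0 :> R by rewrite gt_eqF ?pi_gt0.
have step j : cos (u - pi * (j%:R / N%:R)) ^+ (2 * K) =
    \sum_(z <- s) z.1 * cos (2 * pi * (z.2 0 0)%:~R * (u / pi) -
       2 * pi * (z.2 0 0)%:~R * (j%:R / N%:R)).
  have := fE (const_mx (u / pi - j%:R / N%:R)).
  rewrite /bump big_ord1 mxE mulrBr (mulrC pi (u / pi)) divfK// => ->.
  apply: eq_bigr => z _; congr (_ * cos _).
  by rewrite /dotp big_ord1 !mxE; ring.
rewrite /cos_sample; under eq_bigr do rewrite step.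
rewrite exchange_big /= !big_seq; apply: eq_bigr => z zs.
rewrite -mulr_sumr; congr (_ * _); have [->|z0] := eqVneq.
  under eq_bigr do rewrite mxE mulr0 !mul0r subrr cos0.
  by rewrite sumr_const card_ord.
apply: sum_cos_equidistant.
  have := s_le z zs; rewrite big_ord1 mul1n => zK.
  by rewrite (leq_ltn_trans _ KN)// -lez_nat abszE.
apply: contra z0 => /eqP z0; apply/eqP/rowP => i.
by rewrite ord1 z0 mxE.
Qed.

Lemma cos_sample_ge1 K : (0 < N)%N -> 1 <= cos_sample K 0.
Proof.
move=> N_gt0; rewrite /cos_sample (bigD1 (Ordinal N_gt0))//= mul0r mulr0 subr0.
rewrite cos0 expr1n lerDl sumr_ge0// => j _.
by rewrite exprM exprn_ge0// sqr_ge0.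
Qed.

Let is_derive_sample (f : R -> R) (df : R -> R) t :
  (forall x : R, is_derive x 1 f (df x)) ->
  is_derive t 1 (fun x => \sum_(j < N) f (x - pi * (j%:R / N%:R)))
    (\sum_(j < N) df (t - pi * (j%:R / N%:R))).
Proof.
move=> fd.
have -> : (fun x => \sum_(j < N) f (x - pi * (j%:R / N%:R))) =
    \sum_(j < N) (fun x => f (x - pi * (j%:R / N%:R))).
  by apply/funext => x; rewrite fct_sumE.
apply: is_derive_sum => j.
have h : is_derive t 1 (fun x : R => x - pi * (j%:R / N%:R)) 1.
  by apply: is_derive_eq; rewrite subr0.
have := @is_derive1_comp _ f (fun x : R => x - pi * (j%:R / N%:R)) t _ _ (fd _) h.
by rewrite mulr1.
Qed.

Let sample_const_derive (f df : R -> R) (c : R) :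
  (forall x : R, is_derive x 1 f (df x)) ->
  (forall t, \sum_(j < N) f (t - pi * (j%:R / N%:R)) = c) ->
  forall t, \sum_(j < N) df (t - pi * (j%:R / N%:R)) = 0.
Proof.
move=> fd fc t; have := is_derive_sample t fd.
rewrite (_ : (fun x => _) = cst c); last by apply/funext => x; rewrite fc.
by move=> /@derive_val <-; exact: derive_cst.
Qed.

(** The samples of cos ^ (2 K + 2) have a constant sum, whose second derivative
vanishes: the samples of (2 K + 1) * cos ^ (2 K) * sin ^ 2 have the same sum
as those of cos ^ (2 K + 2), which is at most the sum for cos ^ (2 K). *)
Lemma sample_sin2 K t : (K.+1 < N)%N ->
  \sum_(j < N) cos (t - pi * (j%:R / N%:R)) ^+ (2 * K) *
     sin (t - pi * (j%:R / N%:R)) ^+ 2 * (2 * K + 1)%:R <= cos_sample K 0.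
Proof.
move=> KN.
pose f1 (x : R) := - (sin x * cos x ^+ (2 * K).+1).
have d0 (x : R) : is_derive x 1 (fun x : R => cos x ^+ (2 * K.+1)) ((2 * K.+1)%:R * f1 x).
  have := @is_deriveX _ _ (@cos R) (2 * K.+1) x 1 _ (is_derive_cos x).
  rewrite (_ : cos ^+ _ = fun x => cos x ^+ (2 * K.+1)); last first.
    by apply/funext => y; rewrite exprfctE.
  move/is_derive_eq; apply.
  by rewrite /f1 mulnS add2n /= -[_ *: _]/(_ * _); ring.
have f1_0 : forall t, \sum_(j < N) f1 (t - pi * (j%:R / N%:R)) = 0.
  move=> u; have := sample_const_derive d0 (c := cos_sample K.+1 0) _ u.
  rewrite -mulr_sumr => /(_ (fun v => cos_sample_const v KN)) /eqP.
  by rewrite mulf_eq0 pnatr_eq0 => /orP[//|/eqP].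
pose f2 (x : R) := (2 * K + 1)%:R * (cos x ^+ (2 * K) * sin x ^+ 2) - cos x ^+ (2 * K.+1).
have d1 (x : R) : is_derive x 1 f1 (f2 x).
  have dc := @is_deriveX _ _ (@cos R) (2 * K).+1 x 1 _ (is_derive_cos x).
  have dp := is_deriveN (is_deriveM (is_derive_sin x) dc).
  rewrite (_ : f1 = - (sin * cos ^+ (2 * K).+1)); last first.
    by rewrite opprfctE mulrfctE exprfctE.
  move/is_derive_eq: dp; apply.
  rewrite /f2 /= exprfctE mulnS add2n addn1 -![_ *: _]/(_ * _) !exprS; ring.
have := sample_const_derive d1 f1_0 t; rewrite sumrB -mulr_sumr => /eqP.
rewrite subr_eq0 -/(cos_sample _ _) => /eqP E.
rewrite -mulr_suml mulrC E -(cos_sample_const t (ltnW KN)).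
apply: ler_sum => j _; rewrite mulnS exprD ler_piMl//.
  by rewrite exprM exprn_ge0 ?sqr_ge0.
Qed.
End sampling.

(** * A trigonometric partition of unity *)

Section partition.
Context {R : realType} (n K : nat).
Local Notation N := K.+2.

Let S : R := cos_sample N K 0.

Let S_ge1 : 1 <= S. Proof. exact: cos_sample_ge1. Qed.

Let S_gt0 : 0 < S. Proof. exact: lt_le_trans S_ge1. Qed.

Definition grid_weight (l : 'I_N) (x : R) :=
  cos (pi * x - pi * (l%:R / N%:R)) ^+ (2 * K) / S.

Definition grid_angle (l : 'I_N) (x : R) :=
  `|sin (pi * x - pi * (l%:R / N%:R))|.

Lemma grid_weight_ge0 l x : 0 <= grid_weight l x.
Proof. by rewrite divr_ge0 ?(ltW S_gt0)// exprM exprn_ge0 ?sqr_ge0. Qed.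

Lemma grid_weight_sum x : \sum_l grid_weight l x = 1.
Proof.
rewrite -mulr_suml -/(cos_sample _ _ _) cos_sample_const//.
by rewrite divff ?gt_eqF.
Qed.

(** This bounds the root mean square of grid_angle under the weights. *)
Definition grid_mesh : R := Num.sqrt ((2 * K + 1)%:R^-1).

Lemma grid_weight_angle x : \sum_l grid_weight l x * grid_angle l x <= grid_mesh.
Proof.
set e := grid_mesh.
have e_gt0 : 0 < e by rewrite sqrtr_gt0 invr_gt0 ltr0n addn1.
have e2 : e ^+ 2 * (2 * K + 1)%:R = 1.
  by rewrite sqr_sqrtr ?invr_ge0 ?ler0n// mulVf// pnatr_eq0 addn1.
have sin2 : \sum_l grid_weight l x * grid_angle l x ^+ 2 <= e ^+ 2.
  have := @sample_sin2 R N K (pi * x) (ltnSn _); rewrite -mulr_suml => h.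
  have -> : \sum_l grid_weight l x * grid_angle l x ^+ 2 =
     (\sum_(j < N) cos (pi * x - pi * (j%:R / N%:R)) ^+ (2 * K) *
        sin (pi * x - pi * (j%:R / N%:R)) ^+ 2) / S.
    rewrite mulr_suml; apply: eq_bigr => j _.
    by rewrite real_normK ?num_real// mulrAC.
  have K_gt0 : 0 < (2 * K + 1)%:R :> R by rewrite ltr0n addn1.
  by rewrite ler_pdivrMr// -(ler_pM2r K_gt0) mulrAC e2 mul1r.
have amgm y : y <= (y ^+ 2 / e + e) / 2.
  rewrite ler_pdivlMr// -(ler_pM2r e_gt0) mulrDl divfK ?gt_eqF//.
  by have := sqr_ge0 (y - e); rewrite sqrrB; lra.
apply: (@le_trans _ _ (\sum_l grid_weight l x * ((grid_angle l x ^+ 2 / e + e) / 2))).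
  by apply: ler_sum => l _; rewrite ler_wpM2l ?grid_weight_ge0.
have -> : \sum_l grid_weight l x * ((grid_angle l x ^+ 2 / e + e) / 2) =
   ((\sum_l grid_weight l x * grid_angle l x ^+ 2) / e + e) / 2.
  rewrite -[X in _ / e + X]mulr1 -(grid_weight_sum x) mulr_sumr mulr_suml.
  rewrite -big_split/= mulr_suml; apply: eq_bigr => l _.
  by ring.
rewrite ler_pdivrMr// mulr_natr mulr2n lerD2r ler_pdivrMr//.
Qed.

Local Notation J := {ffun 'I_n -> 'I_N}.

Definition grid_bump (j : J) (x : 'rV[R]_n) := \prod_i grid_weight (j i) (x 0 i).

Definition grid_disp (j : J) (x : 'rV[R]_n) := \sum_i grid_angle (j i) (x 0 i).

Lemma grid_bump_ge0 j x : 0 <= grid_bump j x.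
Proof. by apply: prodr_ge0 => i _; exact: grid_weight_ge0. Qed.

Lemma grid_bump_sum x : \sum_j grid_bump j x = 1.
Proof.
rewrite -(bigA_distr_bigA (fun i l => grid_weight l (x 0 i))).
by rewrite big1// => i _; exact: grid_weight_sum.
Qed.

Lemma grid_disp_ge0 j x : 0 <= grid_disp j x.
Proof. by apply: sumr_ge0 => i _; exact: normr_ge0. Qed.

Lemma grid_disp_le j x : grid_disp j x <= n%:R.
Proof.
apply: le_trans (_ : \sum_(i < n) 1 <= _); last by rewrite sumr_const card_ord.
by apply: ler_sum => i _; exact: sin_max.
Qed.

(** In the product, the i-th summand of the displacement meets only the i-th
weight, and the other weights sum to 1. *)
Lemma grid_bump_disp x : \sum_j grid_bump j x * grid_disp j x <= n%:R * grid_mesh.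
Proof.
under eq_bigr do rewrite mulr_sumr; rewrite exchange_big /=.
apply: le_trans (_ : \sum_(i < n) grid_mesh <= _); last first.
  by rewrite sumr_const card_ord mulr_natl.
apply: ler_sum => i _.
pose F k l := grid_weight l (x 0 k) * (if k == i then grid_angle l (x 0 k) else 1).
rewrite (eq_bigr (fun j : J => \prod_k F k (j k))).
  rewrite -bigA_distr_bigA (bigD1 i)//= [X in _ * X]big1 ?mulr1.
    apply: le_trans (grid_weight_angle (x 0 i)); apply: ler_sum => l _.
    by rewrite /F eqxx.
  move=> k /negPf ki; rewrite -[RHS](grid_weight_sum (x 0 k)).
  by apply: eq_bigr => l _; rewrite /F ki mulr1.
move=> j _; rewrite big_split/= -/(grid_bump _ _); congr (_ * _).
by rewrite -big_mkcond big_pred1_eq.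
Qed.

Definition grid_point (j : J) : 'rV[R]_n := \row_i ((j i)%:R / N%:R).

Lemma grid_bumpE j x : grid_bump j x = bump K (x - grid_point j) / S ^+ n.
Proof.
rewrite /grid_bump /bump big_split/= prodr_const card_ord exprVn; congr (_ / _).
by apply: eq_bigr => i _; rewrite !mxE mulrBr.
Qed.

(** The bumps are translates of one trigonometric polynomial, whose coefficients
are nonnegative with sum at most 1.  Its constant coefficient b is the mean of
every bump up to the largest mean of the other waves. *)
Lemma grid_bump_mean : exists b : R, forall d (T : measurableType d)
    (mu : probability T R) (X : T -> 'rV[R]_n) (E : R), 0 <= E ->
  (forall (k : 'rV[int]_n) (c : R), measurable_fun setT
     (fun p => cos (2 * pi * dotp (int_vec R k) (X p) - c))) ->
  (forall (k : 'rV[int]_n) (c : R), k != 0 -> \sum_i `|k 0 i| <= (n * K)%:Z ->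
     `|\int[mu]_p cos (2 * pi * dotp (int_vec R k) (X p) - c)| <= E) ->
  forall j, mu.-integrable setT (EFin \o (grid_bump j \o X)) /\
    `|\int[mu]_p grid_bump j (X p) - b| <= E.
Proof.
have [s [sE s_ge0 s_le]] := @cos_combination_bump R n K.
have Sn_ge1 : 1 <= S ^+ n by rewrite exprn_ege1.
have Sn_gt0 : 0 < S ^+ n by exact: lt_le_trans Sn_ge1.
exists (\sum_(z <- s) z.1 / S ^+ n * (z.2 == 0)%:R) => d T mu X E E_ge0 mcos cos_le j.
pose c (z : R * 'rV[int]_n) := 2 * pi * dotp (int_vec R z.2) (grid_point j).
pose h z p := cos (2 * pi * dotp (int_vec R z.2) (X p) - c z).
have bumpE p : grid_bump j (X p) = \sum_(z <- s) z.1 / S ^+ n * h z p.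
  rewrite grid_bumpE sE mulr_suml; apply: eq_bigr => z _.
  rewrite /h /c -mulrBr dotpC (dotpC _ (X p)) (dotpC _ (grid_point _)).
  by rewrite dotpDl dotpNl mulrAC.
have int_h z : mu.-integrable setT (EFin \o h z).
  apply: (@probability_bounded_integrable _ _ _ mu (h z) 1); first exact: mcos.
  by move=> p; exact: cos_max.
have int_zh z : mu.-integrable setT (fun p => (z.1 / S ^+ n * h z p)%:E).
  under [X in _.-integrable _ X]eq_fun do rewrite EFinM.
  exact: (integrableZl measurableT (z.1 / S ^+ n) (int_h z)).
have sumE : (EFin \o (grid_bump j \o X)) =
    fun p => (\sum_(z <- s) (z.1 / S ^+ n * h z p)%:E)%E.
  by apply/funext => p /=; rewrite bumpE sumEFin.
split; first by rewrite sumE; exact: integrable_sum.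
have -> : \int[mu]_p grid_bump j (X p) = \sum_(z <- s) z.1 / S ^+ n * \int[mu]_p h z p.
  rewrite /Rintegral -[RHS]/(fine (_%:E)) -sumEFin; congr fine.
  rewrite (eq_integral (fun p => (\sum_(z <- s) (z.1 / S ^+ n * h z p)%:E)%E)).
    rewrite integral_sum//; apply: eq_bigr => z _.
    under eq_integral do rewrite EFinM.
    rewrite integralZl//; last exact: int_h.
    by rewrite [RHS]EFinM fineK//; apply: integrable_fin_num => //; exact: int_h.
  by move=> p _; rewrite sumEFin bumpE.
rewrite -sumrB; apply: le_trans (ler_norm_sum _ _ _) _.
have s1 : \sum_(z <- s) z.1 = 1.
  have := sE 0; rewrite /bump big1 => [->|i _]; last first.
    by rewrite mxE mulr0 cos0 expr1n.
  apply: eq_bigr => z _; rewrite dotpC /dotp big1 ?mulr0 ?cos0 ?mulr1// => i _.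
  by rewrite mxE mul0r.
apply: (@le_trans _ _ (\sum_(z <- s) z.1 / S ^+ n * E)); last first.
  by rewrite -!mulr_suml s1 mul1r ler_piMl// invf_le1.
rewrite !big_seq; apply: ler_sum => z zs.
have zS_ge0 : 0 <= z.1 / S ^+ n by rewrite divr_ge0 ?s_ge0 ?ltW.
rewrite -mulrBr normrM ger0_norm// ler_wpM2l//; have [z0|z0] := eqVneq.
  rewrite (_ : \int[mu]_p h z p = 1) ?subrr ?normr0//.
  rewrite (@eq_Rintegral _ _ _ mu setT (fun=> 1)) => [|p _]; last first.
    rewrite /h /c z0 [int_vec _ _]raddf0 /dotp !big1 ?mulr0 ?subrr ?cos0//.
      by move=> i _; rewrite mxE mul0r.
    by move=> i _; rewrite mxE mul0r.
  by rewrite /Rintegral integral_probability_cst.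
by rewrite subr0; apply: cos_le => //; exact: s_le.
Qed.
End partition.

(** * Geometry and Borel functions of the torus *)

Lemma continuous_measurable_borel (T : ptopologicalType) (R : realType) (f : T -> R) :
  continuous f -> measurable_fun setT (f : borel T -> R).
Proof.
move=> /continuousP cf; apply: (measurability _ (RGenOpens.measurableE R)).
move=> _ [_ [a [b ->] <-]]; rewrite setTI; apply: sub_sigma_algebra.
by apply: cf; exact: interval_open.
Qed.

Lemma continuous_measurable_borel2 (T T' : ptopologicalType) (f : T -> T') :
  continuous f -> measurable_fun setT (f : borel T -> borel T').
Proof.
move=> /continuousP cf; apply: (measurability _ (erefl : @measurable _ (borel T') = _)).
by move=> _ [A oA <-]; rewrite setTI; apply: sub_sigma_algebra; exact: cf.
Qed.

Lemma continuous_sum (T : topologicalType) (R : realType) (I : finType) (f : I -> T -> R) :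
  (forall i, continuous (f i)) -> continuous (fun x => \sum_i f i x).
Proof.
by move=> fc x; apply: (cvg_big add_continuous) => i _; exact: fc.
Qed.

Lemma continuous_prod (T : topologicalType) (R : realType) (I : finType) (f : I -> T -> R) :
  (forall i, continuous (f i)) -> continuous (fun x => \prod_i f i x).
Proof.
by move=> fc x; apply: (cvg_big mul_continuous) => i _; exact: fc.
Qed.

Section torus.
Context {R : realType} {n : nat}.
Implicit Types (a b : 'rV[R]_n) (x y : torus R n).

Definition lift x : 'rV[R]_n := repr x.

Lemma liftK x : to_torus (lift x) = x.
Proof. exact: reprK. Qed.

Lemma lift_to_torus a : exists k : 'rV[int]_n, lift (to_torus a) = a + int_vec R k.
Proof.
have /to_torus_eqP[k kE] : to_torus (lift (to_torus a)) = to_torus a by rewrite liftK.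
by exists k; rewrite -kE addrC subrK.
Qed.

Lemma to_torusD_int a (k : 'rV[int]_n) : to_torus (a + int_vec R k) = to_torus a.
Proof. by apply/to_torus_eqP; exists k; rewrite addrAC subrr add0r. Qed.

Definition periodic_fun (T : Type) (f : 'rV[R]_n -> T) :=
  forall a (k : 'rV[int]_n), f (a + int_vec R k) = f a.

Lemma periodic_lift T (f : 'rV[R]_n -> T) a : periodic_fun f ->
  f (lift (to_torus a)) = f a.
Proof. by move=> fp; have [k ->] := lift_to_torus a; exact: fp. Qed.

Lemma continuous_lift (f : 'rV[R]_n -> R) : continuous f -> periodic_fun f ->
  continuous (f \o lift).
Proof.
move=> cf fp; apply/quotient_continuous.
rewrite (_ : _ \o _ = f)//; apply/funext => a /=.
exact: (periodic_lift a fp).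
Qed.

Lemma enorm_le_l1 (v : 'rV[R]_n) : enorm v <= \sum_i `|v 0 i|.
Proof.
have s_ge0 : 0 <= \sum_i `|v 0 i| by apply: sumr_ge0.
rewrite -[leRHS]ger0_norm// -sqrtr_sqr ler_sqrt ?sqr_ge0//.
rewrite expr2 mulr_suml; apply: ler_sum => i _.
rewrite -[leLHS]ger0_norm; last by rewrite -expr2 sqr_ge0.
by rewrite normrM ler_wpM2l// (bigD1 i)//= lerDl sumr_ge0.
Qed.

Lemma torus_dist_ge0 x y : 0 <= torus_dist x y.
Proof.
apply: lb_le_inf.
  by exists (enorm (lift x - lift y)), (lift x), (lift y); rewrite !liftK.
by move=> _ [a [b [_ _ ->]]]; exact: enorm_ge0.
Qed.

Lemma torus_dist_le a b : torus_dist (to_torus a) (to_torus b) <= enorm (a - b).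
Proof.
apply: ge_inf; last by exists a, b.
by exists 0 => _ [a' [b' [_ _ ->]]]; exact: enorm_ge0.
Qed.

(** Where the cosine is at least 1 / 2, the slope of the sine as a function of
t is at least pi / 2; elsewhere the sine exceeds 1 / 2, the largest distance to
the integers. *)
Lemma nearest_int_sin (t : R) : exists m : int, `|t - m%:~R| <= `|sin (pi * t)|.
Proof.
pose m := Num.floor (t + 2^-1); exists m; set u := t - m%:~R.
have mle : m%:~R <= t + 2^-1 := floor_le _.
have u_le : `|u| <= 2^-1.
  have : t + 2^-1 < (m + 1)%:~R by exact: floorD1_gt.
  rewrite intrD => mgt; rewrite ler_norml; apply/andP; split.
    by rewrite /u; move: mle; lra.
  by rewrite /u; move: mgt; lra.
have -> : `|sin (pi * t)| = `|sin (pi * `|u|)|.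
  rewrite -[t](subrK m%:~R) norm_sinpi_int -/u.
  by have [//|u0] := ger0P u; rewrite mulrN sinN normrN.
move: `|u| (normr_ge0 u) u_le => {}u u_ge0 u_le.
have pi_pos := pi_gt0 R.
have pu_ge0 : 0 <= pi * u by rewrite mulr_ge0// ltW.
have pu_le : pi * u <= pi / 2 by rewrite ler_pM2l.
have pu_le_pi : pi * u <= pi.
  by apply: le_trans pu_le _; rewrite ler_pdivrMr// mulr_natr mulr2n lerDl ltW.
have [cos_ge|cos_lt] := leP 2^-1 (cos (pi * u)).
  have [c] := MVT_segment pu_ge0 (fun (r : R) _ => is_derive_sin r)
    (continuous_subspaceT (@continuous_sin R)).
  rewrite in_itv /= sin0 !subr0 => /andP[c_ge0 c_le] ->.
  have cc : 2^-1 <= cos c.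
    apply: (le_trans cos_ge); rewrite leNgt ltr_cos ?in_itv/= ?pu_ge0 ?c_ge0//.
      by rewrite -leNgt.
    exact: le_trans pu_le_pi.
  rewrite ger0_norm; last by rewrite mulr_ge0// (le_trans _ cc).
  have : 2^-1 * (2 * u) <= cos c * (pi * u).
    by rewrite ler_pM// ?mulr_ge0// ler_wpM2r// pi_ge2.
  by rewrite mulKf// pnatr_eq0.
have cos_ge0 : 0 <= cos (pi * u).
  apply: cos_ge0_pihalf; rewrite pu_le andbT (le_trans _ pu_ge0)//.
  by rewrite oppr_le0 ltW// divr_gt0.
rewrite -[leLHS]ger0_norm// -ler_sqr ?nnegrE// !real_normK ?num_real// sin2cos2.
have u2 : u ^+ 2 <= 2^-1 ^+ 2 by rewrite lerXn2r ?nnegrE.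
have c2 : cos (pi * u) ^+ 2 <= 2^-1 ^+ 2 by rewrite lerXn2r ?nnegrE// ltW.
move: u2 c2; rewrite !exprVn; lra.
Qed.

Lemma torus_dist_le_sin a b :
  torus_dist (to_torus a) (to_torus b) <= \sum_i `|sin (pi * (a 0 i - b 0 i))|.
Proof.
have [m mP] := choice (fun i => nearest_int_sin (a 0 i - b 0 i)).
pose k : 'rV[int]_n := \row_i m i.
rewrite -[to_torus a](to_torusD_int a (- k)).
apply: le_trans (torus_dist_le _ _) (le_trans (enorm_le_l1 _) _).
apply: ler_sum => i _; apply: le_trans (mP i).
by rewrite int_vecN !mxE addrAC.
Qed.

(** The grid point is intermediate: |sin (u - v)| <= |sin u| + |sin v|. *)
Lemma torus_dist_le_disp K (j : {ffun 'I_n -> 'I_K.+2}) x y :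
  torus_dist x y <= grid_disp j (lift x) + grid_disp j (lift y).
Proof.
rewrite -[x in torus_dist x _]liftK -[y in torus_dist _ y]liftK.
apply: le_trans (torus_dist_le_sin _ _) _; rewrite -big_split/=.
apply: ler_sum => i _; rewrite /grid_angle.
move: (lift x 0 i) (lift y 0 i) => s t; set g := pi * (_ / _).
have -> : pi * (s - t) = (pi * s - g) - (pi * t - g) by ring.
rewrite sinB; apply: le_trans (ler_normB _ _) _.
by rewrite !normrM; apply: lerD; [apply: ler_piMr|apply: ler_piMl] => //; exact: cos_max.
Qed.

Lemma periodic_grid_bump K (j : {ffun 'I_n -> 'I_K.+2}) : periodic_fun (@grid_bump R n K j).
Proof.
move=> a k; apply: eq_bigr => i _; rewrite /grid_weight; congr (_ / _).
by rewrite !exprM -!mulrBr !mxE addrAC cos2pi_int.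
Qed.

Lemma periodic_grid_disp K (j : {ffun 'I_n -> 'I_K.+2}) : periodic_fun (@grid_disp R n K j).
Proof.
move=> a k; apply: eq_bigr => i _.
by rewrite /grid_angle -!mulrBr !mxE addrAC norm_sinpi_int.
Qed.

Definition wave (k : 'rV[int]_n) (c : R) a := cos (2 * pi * dotp (int_vec R k) a - c).

Lemma periodic_phase (k : 'rV[int]_n) a (m : 'rV[int]_n) :
  exists z : int, dotp (int_vec R k) (a + int_vec R m) = dotp (int_vec R k) a + z%:~R.
Proof.
exists (\sum_i k 0 i * m 0 i); rewrite dotpC dotpDl dotpC; congr (_ + _).
by rewrite rmorph_sum/=; apply: eq_bigr => i _; rewrite !mxE rmorphM/= mulrC.
Qed.

Lemma periodic_wave k c : periodic_fun (wave k c).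
Proof.
move=> a m; rewrite /wave; have [z ->] := periodic_phase k a m.
by rewrite mulrDr addrAC cosD2pi_int.
Qed.

Lemma continuous_dotp (u : 'rV[R]_n) : continuous (dotp u).
Proof.
apply: continuous_sum => i a.
by apply: continuousM; [exact: cst_continuous|exact: coord_continuous].
Qed.

Lemma continuous_wave k c : continuous (wave k c).
Proof.
move=> a; apply: (@continuous_comp _ _ _ (fun a => 2 * pi * dotp (int_vec R k) a - c) cos).
  apply: continuousB; last exact: cst_continuous.
  by apply: continuousM; [exact: cst_continuous|exact: continuous_dotp].
exact: continuous_cos.
Qed.

Lemma continuous_grid_sin (i : 'I_n) (g : R) : continuous (fun a => sin (pi * a 0 i - g)).
Proof.
move=> a; apply: (@continuous_comp _ _ _ (fun a => pi * a 0 i - g) sin).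
  apply: continuousB; last exact: cst_continuous.
  by apply: continuousM; [exact: cst_continuous|exact: coord_continuous].
exact: continuous_sin.
Qed.

Lemma continuous_grid_cos (i : 'I_n) (g : R) : continuous (fun a => cos (pi * a 0 i - g)).
Proof.
move=> a; apply: (@continuous_comp _ _ _ (fun a => pi * a 0 i - g) cos).
  apply: continuousB; last exact: cst_continuous.
  by apply: continuousM; [exact: cst_continuous|exact: coord_continuous].
exact: continuous_cos.
Qed.

Lemma continuous_grid_disp K (j : {ffun 'I_n -> 'I_K.+2}) : continuous (@grid_disp R n K j).
Proof.
apply: continuous_sum => i a.
apply: (@continuous_comp _ _ _ (fun a : 'rV[R]_n => sin (pi * a 0 i - _)) Num.norm).
  exact: continuous_grid_sin.
exact: norm_continuous.
Qed.

Lemma continuous_grid_bump K (j : {ffun 'I_n -> 'I_K.+2}) : continuous (@grid_bump R n K j).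
Proof.
apply: continuous_prod => i a.
apply: (@continuousM R _ (fun a : 'rV[R]_n => cos (pi * a 0 i - _) ^+ (2 * K))
  (fun=> (cos_sample K.+2 K 0)^-1)); last exact: cst_continuous.
apply: (@continuous_comp _ _ _ (fun a : 'rV[R]_n => cos (pi * a 0 i - _))
  (fun r : R => r ^+ (2 * K))).
  exact: continuous_grid_cos.
exact: exprn_continuous.
Qed.
End torus.

(** * Waves against closed measures *)

Section closed.
Context {R : realType} {n : nat}.
Implicit Types (a : 'rV[R]_n) (k : 'rV[int]_n) (c : R).

Lemma measurable_lift_fst (f : 'rV[R]_n -> R) : continuous f -> periodic_fun f ->
  measurable_fun setT (fun p : borel (tangent R n) => f (lift p.1)).
Proof.
move=> cf fp; apply: (@continuous_measurable_borel (tangent R n)) => p.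
apply: (@continuous_comp _ _ _ fst (f \o lift)); first exact: cvg_fst.
exact: continuous_lift.
Qed.

Lemma measurable_velocity i :
  measurable_fun setT (fun p : borel (tangent R n) => p.2 0 i).
Proof.
apply: (@continuous_measurable_borel (tangent R n)) => p.
apply: (@continuous_comp _ _ _ snd (fun v : 'rV[R]_n => v 0 i)); first exact: cvg_snd.
exact: coord_continuous.
Qed.

Lemma diff_sin_phase k c a : let f b := sin (2 * pi * dotp (int_vec R k) b - c) in
  differentiable f a /\
  forall v, 'd f a v = wave k c a * (2 * pi * dotp (int_vec R k) v).
Proof.
move=> f; pose g b := 2 * pi * dotp (int_vec R k) b.
have g_lin : linear (g : 'rV[R]_n -> R).
  move=> r u v; rewrite /g (dotpC _ (_ + _)) dotpDl !(dotpC _ (int_vec R k)).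
  rewrite mulrDr; congr (_ + _); rewrite -[RHS]/(r * _) mulrCA; congr (_ * _).
  by rewrite /dotp mulr_sumr; apply: eq_bigr => i _; rewrite [(r *: u) 0 i]mxE mulrCA.
pose G : {linear 'rV[R]_n -> R} := HB.pack g (GRing.isLinear.Build _ _ _ _ _ g_lin).
have cG : continuous G.
  move=> b; apply: (@continuousM R _ (fun=> 2 * pi) (dotp (int_vec R k))).
    exact: cst_continuous.
  exact: continuous_dotp.
have dG b : differentiable G b by exact: linear_differentiable.
pose h (r : R) := sin (r - c).
have dh (r : R) : is_derive r 1 h (cos (r - c)).
  have h1 : is_derive r 1 (fun x : R => x - c) 1.
    by apply: is_derive_eq; rewrite subr0.
  have := @is_derive1_comp _ (@sin R) (fun x : R => x - c) r _ _ (is_derive_sin _) h1.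
  by rewrite mulr1.
have dh' r : differentiable h r by apply/derivable1_diffP; case: (dh r).
have fE : f = h \o G by [].
split; first by rewrite fE; exact: differentiable_comp.
have dGE : 'd G a = G :> ('rV[R]_n -> R) by exact: diff_lin.
move=> v; rewrite fE diff_comp// -[LHS]/('d h (G a) ('d G a v)) dGE diff1E//.
by rewrite derive1E (@derive_val _ _ _ _ _ _ _ (dh (G a))) /= -[_ *: _]/(_ * _) mulrC.
Qed.

Definition sin_phase k c (x : torus R n) := sin (2 * pi * dotp (int_vec R k) (lift x) - c).

Lemma sin_phase_to_torus k c :
  sin_phase k c \o @to_torus R n = fun b => sin (2 * pi * dotp (int_vec R k) b - c).
Proof.
apply/funext => b; rewrite /sin_phase /=.
have [m ->] := lift_to_torus b; have [z ->] := periodic_phase k b m.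
rewrite -!cosBpihalf -[RHS](cosD2pi_int _ z); congr cos.
by ring.
Qed.

Lemma C1_torus_sin k c : C1_torus (sin_phase k c).
Proof.
rewrite /C1_torus sin_phase_to_torus; split=> [a|v].
  by have [] := diff_sin_phase k c a.
rewrite (_ : (fun a => 'd _ a v) = fun a => wave k c a * (2 * pi * dotp (int_vec R k) v)).
  move=> a; apply: (@continuousM R _ (wave k c) (fun=> 2 * pi * dotp (int_vec R k) v)).
    exact: continuous_wave.
  exact: cst_continuous.
by apply/funext => a; have [_ ->] := diff_sin_phase k c a.
Qed.

Lemma diff_torus_sin k c x v : diff_torus (sin_phase k c) x v =
  wave k c (lift x) * (2 * pi * dotp (int_vec R k) v).
Proof.
rewrite /diff_torus sin_phase_to_torus.
by have [_ ->] := diff_sin_phase k c (lift x).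
Qed.

(** The l1 norm dominates the Euclidean one and its triangle inequality is
coordinatewise. *)
Definition velocity_dev (w : 'rV[R]_n) (p : tangent R n) := \sum_i `|p.2 0 i - w 0 i|.

Lemma measurable_velocity_dev w :
  measurable_fun setT (velocity_dev w : borel (tangent R n) -> R).
Proof.
apply: measurable_sum => i; apply: measurableT_comp => //.
by apply: measurable_funB => //; exact: measurable_velocity.
Qed.

Lemma velocity_dev_ge0 w p : 0 <= velocity_dev w p.
Proof. exact: sumr_ge0. Qed.

Lemma norm_dotp_le (k : 'rV[int]_n) (v : 'rV[R]_n) :
  `|dotp (int_vec R k) v| <= (\sum_i `|k 0 i|)%:~R * \sum_i `|v 0 i|.
Proof.
rewrite mulr_sumr; apply: le_trans (ler_norm_sum _ _ _) _; apply: ler_sum => i _.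
rewrite normrM mxE -intr_norm ler_wpM2r// ler_int (bigD1 i)//= lerDl.
exact: sumr_ge0.
Qed.

(** Closedness tested on a sine wave says that the mean of wave * <k, v> is 0.
Replacing v by w + (v - w) expresses the mean of the wave, times <k, w>, by the
deviation of the velocity from w. *)
Lemma closed_wave_mean (M : borel_probability (tangent R n) R) (w : 'rV[R]_n)
    (k : 'rV[int]_n) (c q : R) :
  closed_measure M -> (\int[M]_p (velocity_dev w p)%:E <= q%:E)%E ->
  `|dotp (int_vec R k) w| * `|\int[M]_p wave k c (lift p.1)| <=
    (\sum_i `|k 0 i|)%:~R * q.
Proof.
move=> [_ /(_ _ (C1_torus_sin k c))]; under eq_integral do rewrite diff_torus_sin.
move=> M0 Mq.
set kn := (\sum_i `|k 0 i|)%:~R.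
have kn_ge0 : 0 <= kn by rewrite ler0z sumr_ge0.
pose h (p : tangent R n) := wave k c (lift p.1).
pose d (p : tangent R n) := h p * dotp (int_vec R k) (p.2 - w).
have mh : measurable_fun setT (h : borel (tangent R n) -> R).
  by apply: measurable_lift_fst; [exact: continuous_wave|exact: periodic_wave].
have md : measurable_fun setT (d : borel (tangent R n) -> R).
  apply: measurable_funM => //; apply: measurable_sum => i.
  apply: measurable_funM => //; under eq_fun do rewrite !mxE.
  by apply: measurable_funB => //; exact: measurable_velocity.
have d_le p : `|d p| <= kn * velocity_dev w p.
  rewrite normrM; apply: le_trans (_ : 1 * `|dotp (int_vec R k) (p.2 - w)| <= _).
    by rewrite ler_wpM2r// cos_max.
  rewrite mul1r; apply: le_trans (norm_dotp_le _ _) _.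
  by rewrite ler_wpM2l//; apply: ler_sum => i _; rewrite !mxE.
have mE := measurable_velocity_dev w.
have int_abs : (\int[M]_p `|(d p)%:E| <= (kn * q)%:E)%E.
  apply: (@le_trans _ _ (\int[M]_p (kn%:E * (velocity_dev w p)%:E))%E).
    apply: ge0_le_integral => //.
    - exact/measurable_EFinP/measurableT_comp.
    - by apply: emeasurable_funM => //; exact/measurable_EFinP.
    - by move=> p _; rewrite -EFinM lee_fin d_le.
  rewrite ge0_integralZl//; last 2 first.
  - exact/measurable_EFinP.
  - by move=> p _; rewrite lee_fin velocity_dev_ge0.
  by rewrite EFinM lee_wpmul2l.
have int_d : M.-integrable setT (EFin \o d).
  apply/integrableP; split; first exact/measurable_EFinP.
  exact: le_lt_trans int_abs (ltry _).
have ih : M.-integrable setT (EFin \o h).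
  by apply: (@probability_bounded_integrable _ _ _ M h 1) => // p; exact: cos_max.
have kw_h : \int[M]_p d p = - (dotp (int_vec R k) w * \int[M]_p h p).
  pose u := 2 * pi * dotp (int_vec R k) w.
  have E p : wave k c (lift p.1) * (2 * pi * dotp (int_vec R k) p.2) =
      2 * pi * d p + u * h p.
    by rewrite /d /u (dotpC _ (_ - _)) dotpDl dotpNl !(dotpC _ (int_vec R k)) /h; ring.
  move: M0; under eq_integral do rewrite E EFinD !EFinM.
  rewrite integralD//; last 2 first.
  - exact: (integrableZl measurableT (2 * pi) int_d).
  - exact: (integrableZl measurableT u ih).
  rewrite (integralZl measurableT int_d) (integralZl measurableT ih).
  rewrite -(fineK (integrable_fin_num measurableT int_d)).
  rewrite -(fineK (integrable_fin_num measurableT ih)) -!EFinM -EFinD => /(congr1 fine).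
  rewrite [LHS]/= [RHS]/=.
  rewrite -/(\int[M]_p d p) -/(\int[M]_p h p) /u -[2 * pi * dotp _ _ * _]mulrA -mulrDr.
  have pi2 : 2 * pi != 0 :> R by rewrite mulf_neq0 ?pnatr_eq0// gt_eqF ?pi_gt0.
  by move=> /eqP; rewrite mulf_eq0 (negPf pi2) orFb addr_eq0 => /eqP.
rewrite -normrM -normrN -kw_h -lee_fin.
apply: le_trans int_abs; rewrite EFin_normr_Rintegral//.
by apply: le_abse_integral => //; exact/measurable_EFinP.
Qed.
End closed.

(** * Measures carried by loops *)

Lemma integral_uniform01 (R : realType) (g : R -> R) : measurable_fun setT g ->
  (\int[uniform_prob (@ltr01 R)]_s (g s)%:E =
   \int[lebesgue_measure]_(s in `[0%R, 1%R]) (g s)%:E)%E.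
Proof.
move=> mg; have mgE : measurable_fun setT (EFin \o g) by exact/measurable_EFinP.
have unif f : measurable_fun setT f -> (forall s, 0 <= f s)%E ->
    (\int[uniform_prob (@ltr01 R)]_s f s = \int[lebesgue_measure]_(s in `[0%R, 1%R]) f s)%E.
  by move=> mf f0; rewrite integral_uniform// subr0 invr1 mul1e.
rewrite integralE [RHS]integralE !unif//.
- exact: measurable_funeneg.
- exact: measurable_funepos.
Qed.

Section loop.
Context {R : realType} {n : nat}.

Lemma diff_periodic (f : 'rV[R]_n -> R) (a v : 'rV[R]_n) (m : 'rV[int]_n) :
  (forall b, differentiable f b) -> periodic_fun f ->
  'd f (a + int_vec R m) v = 'd f a v.
Proof.
move=> fd fp; rewrite -[LHS]deriveE// -[RHS]deriveE// /derive.
have -> : (fun h : R =>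
      h^-1 *: ((f \o shift (a + int_vec R m)) (h *: v) - f (a + int_vec R m))) =
    (fun h : R => h^-1 *: ((f \o shift a) (h *: v) - f a)).
  by apply/funext => h; rewrite /= addrA !fp.
by [].
Qed.

Lemma diff_torusE (phi : torus R n -> R) (a v : 'rV[R]_n) : C1_torus phi ->
  diff_torus phi (to_torus a) v = 'd (phi \o @to_torus R n) a v.
Proof.
move=> [fd _]; rewrite /diff_torus -/(lift (to_torus a)).
have [m ->] := lift_to_torus a; apply: (diff_periodic _ _ _ fd) => b m'.
by rewrite /= to_torusD_int.
Qed.

Lemma measurable_diff_torus (phi : torus R n -> R) : C1_torus phi ->
  measurable_fun setT (fun p : borel (tangent R n) => diff_torus phi p.1 p.2).
Proof.
move=> C1; have [fd fc] := C1; set f := phi \o _ in fd fc.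
pose e i : 'rV[R]_n := delta_mx 0 i.
have mi i : measurable_fun setT
    (fun p : borel (tangent R n) => p.2 0 i * ('d f (lift p.1) (e i) : R)).
  apply: measurable_funM; first exact: (measurable_velocity i).
  apply: (measurable_lift_fst (f := fun a => 'd f a (e i))); first exact: fc.
  move=> a m; apply: (diff_periodic _ _ _ fd) => b m'.
  by rewrite /f /= to_torusD_int.
rewrite (_ : (fun p => _) =
  fun p : borel (tangent R n) => \sum_i p.2 0 i * ('d f (lift p.1) (e i) : R)).
  exact: measurable_sum.
apply/funext => p; rewrite /diff_torus -/(lift _) -/f {1}(row_sum_delta p.2).
by rewrite linear_sum/=; apply: eq_bigr => i _; rewrite linearZ.
Qed.

Lemma is_derive_line (f : 'rV[R]_n -> R) (K : 'rV[R]_n) (s : R) :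
  differentiable f (s *: K) ->
  is_derive s 1 (fun r : R => f (r *: K)) ('d f (s *: K) K).
Proof.
move=> fd; have quotE : (fun h : R =>
      h^-1 *: (((fun r : R => f (r *: K)) \o shift s) (h *: 1) - f (s *: K))) =
    (fun h : R => h^-1 *: ((f \o shift (s *: K)) (h *: K) - f (s *: K))).
  apply/funext => h /=; congr (_ *: (f _ - _)).
  by rewrite scalerDl -[h *: 1]/(h * 1) mulr1.
apply: DeriveDef.
  by rewrite /derivable quotE; exact: diff_derivable.
by rewrite -deriveE// /derive quotE.
Qed.

Variables (k : 'rV[int]_n) (t : R) (u : 'rV[R]_n).
Hypotheses (t_gt0 : 0 < t) (tu : t *: u = int_vec R k).

Let loop (s : R) : tangent R n := (to_torus (s *: int_vec R k), u).

Let continuous_loop : continuous loop.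
Proof.
have cl : continuous (fun s : R => to_torus (s *: int_vec R k)).
  move=> s; apply: (@continuous_comp _ _ _ (fun r : R => r *: int_vec R k) (@to_torus R n)).
    exact: scalel_continuous.
  exact: pi_continuous.
have : continuous (fun s : R => (to_torus (s *: int_vec R k), u) : torus R n * 'rV[R]_n).
  move=> s; have cu : continuous (fun _ : R => u) by exact: cst_continuous.
  exact: (cvg_pair (cl s) (cu s)).
by [].
Qed.

Let measurable_loop : measurable_fun setT (loop : measurableTypeR R -> borel (tangent R n)).
Proof.
apply: (measurability _ (erefl : @measurable _ (borel (tangent R n)) = _)).
move=> _ [A oA <-]; rewrite setTI; apply: open_measurable.
by move/continuousP: continuous_loop; exact.
Qed.

Let loop_mfun : {mfun measurableTypeR R >-> borel (tangent R n)} :=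
  HB.pack (loop : measurableTypeR R -> borel (tangent R n))
    (isMeasurableFun.Build _ _ _ _
      (loop : measurableTypeR R -> borel (tangent R n)) measurable_loop).

Definition loop_measure : borel_probability (tangent R n) R :=
  distribution (uniform_prob (@ltr01 R)) loop_mfun.

Lemma integral_loop_measure (g : tangent R n -> R) :
  measurable_fun setT (g : borel (tangent R n) -> R) -> continuous (g \o loop) ->
  (\int[loop_measure]_p (g p)%:E =
   \int[lebesgue_measure]_(s in `[0%R, 1%R]) (g (loop s))%:E)%E.
Proof.
move=> mg cg; have mgl : measurable_fun setT (g \o loop) by exact: continuous_measurable_fun.
rewrite /loop_measure integral_distribution; last 2 first.
- exact/measurable_EFinP.
- apply/integrableP; split; first exact/measurable_EFinP.
  have -> : (\int[uniform_prob (@ltr01 R)]_s `|(EFin \o g \o loop_mfun) s| =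
      \int[uniform_prob (@ltr01 R)]_s (`|g (loop s)|)%:E)%E by [].
  rewrite integral_uniform01; last exact: measurableT_comp.
  have : lebesgue_measure.-integrable `[0%R, 1%R] (EFin \o (fun s : R => `|g (loop s)|)).
    apply: continuous_compact_integrable; first exact: segment_compact.
    apply: continuous_subspaceT => s.
    by apply: (@continuous_comp _ _ _ (g \o loop) Num.norm); [exact: cg|exact: norm_continuous].
  have mgn : measurable_fun setT (fun s : R => (`|g (loop s)|)%:E).
    by apply/measurable_EFinP; exact: measurableT_comp.
  move=> /integrableP[_]; apply: le_lt_trans; apply: ge0_le_integral => //.
  + exact: measurable_funTS.
  + by apply: measurable_funTS; exact: measurableT_comp.
  + by move=> s _; rewrite /= normr_id.
exact: integral_uniform01.
Qed.

(** The differential of phi integrates along the loop to the difference of the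
values at its ends, which are one point of the torus. *)
Lemma loop_measure_closed : closed_measure loop_measure.
Proof.
split.
  have me : measurable_fun setT (fun p : borel (tangent R n) => enorm p.2).
    have ms : measurable_fun setT (@Num.sqrt R).
      by apply: continuous_measurable_fun; exact: sqrt_continuous.
    apply: (measurableT_comp ms).
    by apply: measurable_sum => i; apply: measurable_funM; exact: (measurable_velocity i).
  rewrite (integral_loop_measure me); last by move=> s; exact: cst_continuous.
  rewrite [X in (X < _)%E](_ : _ = (enorm u)%:E%E) ?ltry//=.
  by rewrite integral_cst//= lebesgue_measure_itv/= lte_fin ltr01 oppr0 adde0 mule1.
move=> phi C1; have [fd fc] := C1; set f := phi \o _ in fd fc.
pose D (s : R) : R := 'd f (s *: int_vec R k) (int_vec R k).
have gE s : diff_torus phi (loop s).1 (loop s).2 = t^-1 * D s.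
  rewrite (diff_torusE _ _ C1) -/f /D; move: (s *: int_vec R k) => A.
  by rewrite -tu linearZ /= -[t *: _]/(t * _) mulKf// gt_eqF.
have cD : continuous D.
  move=> s; apply: (@continuous_comp _ _ _ (fun s : R => s *: int_vec R k)
    (fun a => 'd f a (int_vec R k))); [exact: scalel_continuous|exact: fc].
have cd : continuous (fun s : R => t^-1 * D s).
  by move=> s; apply: (@continuousM R _ (fun=> t^-1) D); [exact: cst_continuous|exact: cD].
rewrite (integral_loop_measure (measurable_diff_torus C1)); last first.
  by rewrite (_ : _ \o _ = fun s => t^-1 * D s)//; apply/funext => s; rewrite -gE.
under eq_integral do rewrite gE.
have dF (s : R) : is_derive s 1 (fun r : R => t^-1 * f (r *: int_vec R k)) (t^-1 * D s).
  exact: (is_deriveZ _ (is_derive_line (fd _))).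
have cF : continuous (fun r : R => t^-1 * f (r *: int_vec R k)).
  by move=> s; apply: differentiable_continuous; apply/derivable1_diffP; case: (dF s).
rewrite (@continuous_FTC2 _ _ (fun r : R => t^-1 * f (r *: int_vec R k)))//.
- rewrite scale1r scale0r /f /= -{1}[int_vec R k]add0r to_torusD_int.
  by rewrite -EFinB subrr.
- exact: continuous_subspaceT.
- by split=> [s _||]; [case: (dF s)|exact/cvg_at_right_filter/cF|exact/cvg_at_left_filter/cF].
- by move=> s _; rewrite derive1E; exact: derive_val.
Qed.

Lemma loop_measure_energy (g : tangent R n -> R) (c : R) :
  measurable_fun setT (g : borel (tangent R n) -> R) -> (forall p, 0 <= g p) ->
  (forall x, g (x, u) <= c) -> (\int[loop_measure]_p (g p)%:E <= c%:E)%E.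
Proof.
move=> mg g_ge0 gc; rewrite /loop_measure ge0_integral_distribution; last 2 first.
- exact/measurable_EFinP.
- by move=> p; rewrite lee_fin.
apply: (@le_trans _ _ (\int[uniform_prob (@ltr01 R)]_s c%:E)%E).
  apply: ge0_le_integral => //.
  - by move=> s _; rewrite lee_fin.
  - by apply/measurable_EFinP; exact: measurableT_comp.
  - by move=> s _; rewrite lee_fin; exact: gc.
by rewrite integral_probability_cst.
Qed.
End loop.

(** * Velocities of Mather measures *)

Lemma continuous_at_dominated (R : realType) (T : topologicalType) (f G : T -> R) (a : T) :
  {for a, continuous G} -> G a = 0 -> (forall b, `|f a - f b| <= G b) ->
  {for a, continuous f}.
Proof.
move=> cG Ga fG; apply/cvgrPdist_le => e e_gt0.
have /cvgrPdist_le/(_ e e_gt0) := cG; apply: filterS => b.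
rewrite Ga sub0r normrN => Gb.
by apply: le_trans (fG b) (le_trans _ Gb); exact: ler_norm.
Qed.

Lemma lipschitz_field_measurable (R : realType) n (V : torus R n -> 'rV[R]_n) i :
  lipschitz_field V -> measurable_fun setT (fun x : borel (torus R n) => V x 0 i).
Proof.
move=> [K VK]; apply: (@continuous_measurable_borel (torus R n)).
apply/quotient_continuous => a; set f : 'rV[R]_n -> R := _ \o _.
pose G (b : 'rV[R]_n) : R := `|K| * \sum_j `|a 0 j - b 0 j|.
have fG b : `|f a - f b| <= G b.
  have := coord_le_enorm (V (to_torus a) - V (to_torus b)) i; rewrite !mxE.
  move/le_trans; apply; apply: le_trans (VK _ _) _.
  apply: (@le_trans _ _ (`|K| * torus_dist (to_torus a) (to_torus b))).
    by rewrite ler_wpM2r ?torus_dist_ge0// ler_norm.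
  rewrite ler_wpM2l//; apply: le_trans (torus_dist_le _ _) _.
  by apply: le_trans (enorm_le_l1 _) _; apply: ler_sum => j _; rewrite !mxE.
have cG : continuous G.
  move=> b; apply: (@continuousM R _ (fun=> `|K|)); first exact: cst_continuous.
  apply: continuous_sum => j {}b.
  apply: (@continuous_comp _ _ _ (fun b : 'rV[R]_n => a 0 j - b 0 j) Num.norm);
    last exact: norm_continuous.
  by apply: (@continuousB _ _ _ (fun=> a 0 j)); [exact: cst_continuous|exact: coord_continuous].
have Ga : G a = 0.
  by rewrite /G big1 ?mulr0// => j _; rewrite subrr normr0.
exact: (continuous_at_dominated (cG a) Ga).
Qed.

Lemma enorm_sqr (R : realType) n (v : 'rV[R]_n) : enorm v ^+ 2 = \sum_i v 0 i ^+ 2.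
Proof. by rewrite sqr_sqrtr ?dotp_ge0//; apply: eq_bigr => i _; rewrite expr2. Qed.

Lemma lagrangian_ge0 (R : realType) n (V : torus R n -> 'rV[R]_n) p : 0 <= lagrangian V p.
Proof. by rewrite mulr_ge0 ?sqr_ge0. Qed.

Lemma measurable_lagrangian (R : realType) n (V : torus R n -> 'rV[R]_n) :
  lipschitz_field V -> measurable_fun setT (lagrangian V : borel (tangent R n) -> R).
Proof.
move=> VL; apply: measurable_funM => //; under eq_fun do rewrite enorm_sqr.
apply: measurable_sum => i; apply: measurable_funX; under eq_fun do rewrite !mxE.
apply: measurable_funB; first exact: measurable_velocity.
apply: (measurableT_comp (lipschitz_field_measurable i VL)).
by apply: (@continuous_measurable_borel2 (tangent R n) (torus R n)) => p; exact: cvg_fst.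
Qed.

Lemma rational_approx (R : realType) n (w : 'rV[R]_n) (e : R) : 0 < e ->
  exists (k : 'rV[int]_n) (t : R) (u : 'rV[R]_n),
    [/\ 0 < t, t *: u = int_vec R k & forall i, `|u 0 i - w 0 i| <= e].
Proof.
move=> e_gt0; pose t : R := e^-1.
have t_gt0 : 0 < t by rewrite invr_gt0.
pose k : 'rV[int]_n := \row_i Num.floor (t * w 0 i).
exists k, t, (t^-1 *: int_vec R k); split=> [//||i].
  by rewrite scalerA divff ?gt_eqF// scale1r.
rewrite !mxE -(ler_pM2l t_gt0) /t mulVf ?gt_eqF// -/t.
rewrite -[X in X * `|_|](gtr0_norm t_gt0) -normrM mulrBr mulVKf ?gt_eqF//.
rewrite distrC ger0_norm ?subr_ge0 ?floor_le//.
have := floorD1_gt (t * w 0 i); rewrite intrD => h; apply: ltW.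
by rewrite ltrBlDl.
Qed.

Section velocity.
Context {R : realType} {n : nat} (n_gt0 : (0 < n)%N).
Variables (w : 'rV[R]_n) (V : torus R n -> 'rV[R]_n) (d : R).
Hypotheses (VL : lipschitz_field V) (d_ge0 : 0 <= d)
  (Vw : forall x, enorm (V x - w) <= d).
Variable (M : borel_probability (tangent R n) R).
Hypothesis (matherM : mather_measure (lagrangian V) M).

Let n_ge1 : 1 <= n%:R :> R. Proof. by rewrite ler1n. Qed.

(** The competitors are loops with rational velocity within e of w. *)
Lemma mather_energy (e : R) : 0 < e ->
  (\int[M]_p (lagrangian V p)%:E <= (2^-1 * (n%:R * (d + e)) ^+ 2)%:E)%E.
Proof.
move=> e_gt0; have [k [t [u [t_gt0 tu uw]]]] := rational_approx w e_gt0.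
apply: le_trans (matherM.2 _ (loop_measure_closed t_gt0 tu)) _.
apply: loop_measure_energy => [|p|x]; first exact: measurable_lagrangian.
  exact: lagrangian_ge0.
rewrite /lagrangian ler_wpM2l ?invr_ge0// enorm_sqr.
apply: (@le_trans _ _ (\sum_(i < n) (d + e) ^+ 2)).
  apply: ler_sum => i _; rewrite -[leLHS]ger0_norm ?sqr_ge0// normrX.
  rewrite lerXn2r ?nnegrE ?addr_ge0 ?(ltW e_gt0)// !mxE.
  have := le_trans (coord_le_enorm _ i) (Vw x); rewrite !mxE => Vi.
  have -> : u 0 i - V x 0 i = (u 0 i - w 0 i) - (V x 0 i - w 0 i) by ring.
  by apply: le_trans (ler_normB _ _) _; rewrite addrC lerD.
(* The n coordinates contribute a factor n <= n ^ 2, which makes the bound a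
   perfect square. *)
rewrite sumr_const card_ord -[leLHS]mulr_natl exprMn ler_wpM2r ?sqr_ge0//.
by rewrite expr2 ler_peMl.
Qed.

(** |v - w| <= |v - V| + d, and |v - V| <= (|v - V| ^ 2 / r + r) / 2 turns the
energy bound into one of first order when r is its square root. *)
Lemma mather_velocity_dev :
  (\int[M]_p (velocity_dev w p)%:E <= (n%:R * (n%:R + 1) * d)%:E)%E.
Proof.
apply/lee_addgt0Pr => e' e'_gt0.
pose e := e' / n%:R ^+ 2.
have n_pos : 0 < n%:R :> R by rewrite ltr0n.
have e_gt0 : 0 < e by rewrite divr_gt0// exprn_gt0.
pose r := n%:R * (d + e).
have r_gt0 : 0 < r by rewrite mulr_gt0// ltr_wpDl.
have pointwise p : velocity_dev w p <= n%:R / r * lagrangian V p + n%:R * (r / 2 + d).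
  pose L := enorm (p.2 - V p.1).
  have term_le i : `|p.2 0 i - w 0 i| <= (L ^+ 2 / r + r) / 2 + d.
    have -> : p.2 0 i - w 0 i = (p.2 0 i - V p.1 0 i) + (V p.1 0 i - w 0 i) by ring.
    apply: le_trans (ler_normD _ _) _; apply: lerD.
      apply: (@le_trans _ _ L).
        by have := coord_le_enorm (p.2 - V p.1) i; rewrite !mxE.
      rewrite ler_pdivlMr// -(ler_pM2r r_gt0) mulrDl divfK ?gt_eqF//.
      by have := sqr_ge0 (L - r); rewrite sqrrB; lra.
    by have := le_trans (coord_le_enorm _ i) (Vw p.1); rewrite !mxE.
  apply: (@le_trans _ _ (\sum_(i < n) ((L ^+ 2 / r + r) / 2 + d))).
    exact: ler_sum.
  rewrite sumr_const card_ord -[leLHS]mulr_natl /lagrangian -/L.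
  by rewrite le_eqVlt; apply/orP; left; apply/eqP; field; rewrite gt_eqF.
have mL := measurable_lagrangian VL.
apply: (@le_trans _ _ (\int[M]_p
  ((n%:R / r)%:E * (lagrangian V p)%:E + (n%:R * (r / 2 + d))%:E))%E).
  apply: ge0_le_integral => //.
  - by move=> p _; rewrite lee_fin velocity_dev_ge0.
  - by apply/measurable_EFinP; exact: measurable_velocity_dev.
  - apply: emeasurable_funD => //; apply: emeasurable_funM => //.
    exact/measurable_EFinP.
  - by move=> p _; rewrite -EFinM -EFinD lee_fin.
have nr_ge0 : 0 <= n%:R / r by rewrite divr_ge0 ?ltW.
have c_ge0 : 0 <= n%:R * (r / 2 + d).
  by rewrite mulr_ge0 ?ler0n// addr_ge0// divr_ge0 ?ltW.
rewrite ge0_integralD//; last 2 first.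
- by move=> p _; rewrite -EFinM lee_fin mulr_ge0// lagrangian_ge0.
- by apply: emeasurable_funM => //; exact/measurable_EFinP.
rewrite ge0_integralZl//; last 2 first.
- exact/measurable_EFinP.
- by move=> p _; rewrite lee_fin lagrangian_ge0.
rewrite integral_probability_cst.
apply: (@le_trans _ _ ((n%:R / r)%:E * (2^-1 * r ^+ 2)%:E + (n%:R * (r / 2 + d))%:E)%E).
  by rewrite leeD2r// lee_wpmul2l ?lee_fin// mather_energy.
rewrite -EFinM -!EFinD lee_fin; rewrite le_eqVlt; apply/orP; left; apply/eqP.
have -> : e' = n%:R ^+ 2 * e by rewrite mulrC divfK// gt_eqF ?exprn_gt0.
have -> : n%:R / r * (2^-1 * r ^+ 2) = n%:R * r / 2 by field; rewrite gt_eqF.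
by rewrite /r; field.
Qed.
End velocity.

(** * From Fourier coefficients to the Wasserstein distance *)

(** When the waves of low frequency have mean 0 for nu, all bumps have the same
nu-mass b = K.+2 ^- n, while their mu-masses are at most b + E; the damping
factor of the coupling is b / (b + E), and 1 minus it is at most E / b. *)
Lemma wasserstein1_wave_le d (T : measurableType d) (R : realType) n K
    (nu mu : probability T R) (X : T -> 'rV[R]_n) (dist : T -> T -> R) (q : T -> R)
    (E : R) : 0 <= E ->
  (forall (k : 'rV[int]_n) c, measurable_fun setT (fun p => wave k c (X p))) ->
  (forall j, measurable_fun setT (fun p => @grid_bump R n K j (X p))) ->
  (forall j, measurable_fun setT (fun p => @grid_disp R n K j (X p))) ->
  (forall (k : 'rV[int]_n) c, k != 0 -> \sum_i `|k 0 i| <= (n * K)%:Z ->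
     \int[nu]_p wave k c (X p) = 0) ->
  (forall (k : 'rV[int]_n) c, k != 0 -> \sum_i `|k 0 i| <= (n * K)%:Z ->
     `|\int[mu]_p wave k c (X p)| <= E) ->
  measurable_fun setT q -> (forall p, 0 <= q p) ->
  (forall p p', 0 <= dist p p') ->
  (forall (j : {ffun 'I_n -> 'I_K.+2}) p p', dist p p' <=
     grid_disp j (X p) + grid_disp j (X p') + (q p + q p')) ->
  (wasserstein1 nu mu dist <=
    (2 * (n%:R * grid_mesh K) + 2 * n%:R * (K.+2%:R ^+ n * E))%:E +
     (\int[nu]_p (q p)%:E + \int[mu]_p (q p)%:E))%E.
Proof.
move=> E_ge0 mwave mbump mdisp nu_wave mu_wave mq q_ge0 dist_ge0 dist_le.
have [b bP] := @grid_bump_mean R n K.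
have nuP := bP _ _ nu X 0 (lexx _) mwave _.
have muP := bP _ _ mu X E E_ge0 mwave mu_wave.
have {nuP} nuP j : nu.-integrable setT (EFin \o (@grid_bump R n K j \o X)) /\
    \int[nu]_p grid_bump j (X p) = b.
  have [k c k0 kle|ij] := nuP _ j.
    by rewrite [X in `|X|](nu_wave k c k0 kle) normr0.
  by rewrite normr_le0 subr_eq0 => /eqP.
pose a j : R := \int[mu]_p @grid_bump R n K j (X p).
have int_nu j : (\int[nu]_p (@grid_bump R n K j (X p))%:E = b%:E)%E.
  have [ij <-] := nuP j; rewrite fineK//; exact: (integrable_fin_num measurableT ij).
have int_mu j : (\int[mu]_p (@grid_bump R n K j (X p))%:E = (a j)%:E)%E.
  have [ij _] := muP j; rewrite fineK//; exact: (integrable_fin_num measurableT ij).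
have b_sum : K.+2%:R ^+ n * b = 1.
  apply: EFin_inj; rewrite -natrX mulr_natl.
  have -> : (K.+2 ^ n)%N = #|{ffun 'I_n -> 'I_K.+2}| by rewrite card_ffun !card_ord.
  rewrite -sumr_const -sumEFin (eq_bigr _ (fun j _ => esym (int_nu j))).
  rewrite -ge0_integral_sum//; last 2 first.
  - by move=> j; exact/measurable_EFinP.
  - by move=> j p _; rewrite lee_fin grid_bump_ge0.
  under eq_integral do rewrite sumEFin grid_bump_sum.
  exact: integral_probability_cst.
have N_gt0 : 0 < K.+2%:R ^+ n :> R by rewrite exprn_gt0 ?ltr0n.
have b_gt0 : 0 < b by rewrite -(pmulr_rgt0 _ N_gt0) b_sum.
pose t := b / (b + E).
have bE_gt0 : 0 < b + E by rewrite ltr_wpDr.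
have t_ge0 : 0 <= t by rewrite divr_ge0 ?ltW.
have ab j : t * a j <= b.
  have [_] := muP j; rewrite -/(a j) ler_distl => /andP[_ aE].
  rewrite /t mulrAC ler_pdivrMr// ler_pM2l//.
apply: le_trans (wasserstein1_partition_le
  (f := fun j p => grid_bump j (X p)) (a := a) (b := b) (t := t)
  mbump _ _ b_gt0 t_ge0 int_nu int_mu ab
  (p := fun j p => grid_disp j (X p)) (q := q) (D := n%:R)
  (P := n%:R * grid_mesh K) mdisp mq _ q_ge0 _ dist_ge0 dist_le) _.
- by move=> j p; exact: grid_bump_ge0.
- by move=> p; exact: grid_bump_sum.
- by move=> j p; rewrite grid_disp_ge0 grid_disp_le.
- by move=> p; exact: grid_bump_disp.
rewrite leeD2r// lee_fin lerD2l ler_wpM2l ?mulr_ge0//.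
have -> : 1 - t = E / (b + E).
  by rewrite /t -[1](divff (lt0r_neq0 bE_gt0)) -mulrBl addrAC subrr add0r.
rewrite ler_pdivrMr// mulrDr mulrAC b_sum mul1r lerDl.
exact: mulr_ge0 (mulr_ge0 (ltW N_gt0) E_ge0) E_ge0.
Qed.

(** A real exponent can be rounded up since nonzero integer vectors have norm at
least 1. *)
Lemma diophantine_nat (R : realType) n (w : 'rV[R]_n) : nonresonant w ->
  (exists s t : R, [/\ 0 < s, n%:R - 1 <= t & diophantine s t w]) \/
    (forall i : 'I_n, algebraic_real (w 0 i)) ->
  exists s m, 0 < s /\ forall k : 'rV[int]_n, k != 0 ->
    s <= enorm (int_vec R k) ^+ m * `|dotp w (int_vec R k)|.
Proof.
move=> wnr [[s [t [s_gt0 _ wd]]]|]; last exact: algebraic_diophantine.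
exists s, (Num.bound `|t|); split=> // k k0.
have e_ge1 := enorm_int_vec_ge1 R k0; set e := enorm _ in e_ge1 *.
have e_gt0 : 0 < e by exact: lt_le_trans e_ge1.
have := wd k k0; rewrite -/e powRN ler_pdivrMr ?powR_gt0// => /le_trans; apply.
rewrite mulrC ler_wpM2r// -powR_mulrn ?(ltW e_gt0)// ler_powR//.
apply: le_trans (ler_norm t) _; apply: ltW.
exact: archi_boundP.
Qed.

Lemma enorm_int_vec_le (R : realType) n (k : 'rV[int]_n) (m : nat) :
  \sum_i `|k 0 i| <= m%:Z -> enorm (int_vec R k) <= m%:R.
Proof.
move=> km; apply: le_trans (enorm_le_l1 _) _.
rewrite -[m%:R]/((m%:Z)%:~R) -(ler_int R) in km *; apply: le_trans km.
by rewrite rmorph_sum/=; apply: ler_sum => i _; rewrite mxE intr_norm.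
Qed.

Lemma mather_wave_mean (R : realType) n (n_gt0 : (0 < n)%N) (w : 'rV[R]_n)
    (s : R) (m K : nat) (V : torus R n -> 'rV[R]_n) (d : R) (M : borel_probability (tangent R n) R)
    (k : 'rV[int]_n) (c : R) :
  0 < s ->
  (forall k : 'rV[int]_n, k != 0 ->
    s <= enorm (int_vec R k) ^+ m * `|dotp w (int_vec R k)|) ->
  lipschitz_field V -> 0 <= d -> (forall x, enorm (V x - w) <= d) ->
  mather_measure (lagrangian V) M ->
  k != 0 -> \sum_i `|k 0 i| <= (n * K)%:Z ->
  `|\int[M]_p wave k c (lift p.1)| <=
    (n * K)%:R ^+ m.+1 * (n%:R * (n%:R + 1)) / s * d.
Proof.
move=> s_gt0 dioph VL d_ge0 Vw MV k0 kle.
have dev := mather_velocity_dev n_gt0 VL d_ge0 Vw MV.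
have := closed_wave_mean k c MV.1 dev; rewrite dotpC.
set I := `|\int[M]_p _|; set a := `|dotp _ _| => Ia.
have I_ge0 : 0 <= I by exact: normr_ge0.
have kR : (\sum_i `|k 0 i|)%:~R <= (n * K)%:R :> R.
  by rewrite -[(n * K)%:R]/(((n * K)%:Z)%:~R) ler_int.
have e_ge0 : 0 <= enorm (int_vec R k) by exact: enorm_ge0.
have nd_ge0 : 0 <= n%:R * (n%:R + 1) * d by rewrite !mulr_ge0 ?addr_ge0 ?ler0n.
rewrite mulrAC ler_pdivlMr// mulrC.
apply: (@le_trans _ _ (enorm (int_vec R k) ^+ m * a * I)).
  by rewrite ler_wpM2r//; exact: dioph.
rewrite -mulrA exprSr -!mulrA; apply: ler_pM => //.
- by rewrite exprn_ge0.
- exact: mulr_ge0 (normr_ge0 _) I_ge0.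
- by rewrite lerXn2r ?nnegrE ?ler0n// enorm_int_vec_le.
by apply: (le_trans Ia); rewrite [n%:R * (_ * d)]mulrA ler_wpM2r.
Qed.

(** K is the integer part of x = y ^- 2 = delta ^ (- 1 / (n + m + 2)): the width of
the bumps is at most y, and their accumulated error is of order
x ^+ (n + m + 1) * delta = y ^+ 2. *)
Lemma scale_choice (R : realType) (n m : nat) (delta A : R) :
  0 < delta -> delta < 1 -> 0 <= A ->
  let y := delta `^ (2 * (n + m + 2)%:R)^-1 in
  exists K, [/\ grid_mesh K <= y, delta <= y &
    K.+2%:R ^+ n * ((n * K)%:R ^+ m.+1 * A * delta) <= 3 ^+ n * n%:R ^+ m.+1 * A * y].
Proof.
move=> delta_gt0 delta_lt1 A_ge0 y; pose D0 := (n + m + 2)%N.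
have D0_gt0 : 0 < D0%:R :> R by rewrite ltr0n /D0 addn2.
have y_gt0 : 0 < y by exact: powR_gt0.
have yD : y ^+ (2 * D0) = delta.
  rewrite -powR_mulrn ?(ltW y_gt0)// /y -powRrM natrM mulVf ?powRr1 ?(ltW delta_gt0)//.
have y_le1 : y <= 1.
  rewrite leNgt; apply/negP => y_gt1; move: delta_lt1; rewrite ltNge -yD.
  by rewrite exprn_ege1// ltW.
pose x := y ^- 2; have x_ge1 : 1 <= x by rewrite invf_ge1 ?exprn_gt0// expr_le1// ltW.
pose K := Num.truncn x; exists K.
have x_ge0 : 0 <= x by exact: le_trans x_ge1.
have Kx : K%:R <= x by rewrite truncn_le.
have xK : x < K.+1%:R by rewrite truncnS_gt.
have delta_y : delta <= y.
  by rewrite -yD -[leRHS]expr1; apply: ler_wiXn2l => //; [exact: ltW|rewrite /D0 addn2 mulnS].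
split=> //.
- rewrite /grid_mesh -[y]ger0_norm ?(ltW y_gt0)// -sqrtr_sqr ler_sqrt ?sqr_ge0//.
  rewrite -[y ^+ 2]invrK lef_pV2 ?posrE ?ltr0n ?addn1 ?invr_gt0 ?exprn_gt0//.
  by apply: le_trans (ltW xK) _; rewrite ler_nat ltnS mul2n -addnn leq_addr.
have K2 : K.+2%:R <= 3 * x.
  rewrite -[K.+2]addn2 natrD; apply: le_trans (lerD Kx (lexx _)) _.
  by move: x_ge1; lra.
have nK : (n * K)%:R <= n%:R * x by rewrite natrM ler_wpM2l.
have xy : x ^+ (n + m.+1) * delta <= y.
  rewrite -yD /x exprVn -exprM /D0.
  have -> : (2 * (n + m + 2) = 2 * (n + m.+1) + 2)%N by rewrite addn2 -addn1 !mulnDr; lia.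
  rewrite exprD mulrA mulVf ?mul1r ?expf_neq0 ?gt_eqF//.
  by rewrite expr2 ler_piMl// ltW.
apply: (@le_trans _ _ ((3 * x) ^+ n * ((n%:R * x) ^+ m.+1 * A * delta))).
  apply: ler_pM.
  - by rewrite exprn_ge0.
  - by rewrite !mulr_ge0 ?exprn_ge0 ?(ltW delta_gt0).
  - by rewrite lerXn2r ?nnegrE ?mulr_ge0.
  rewrite ler_wpM2r ?(ltW delta_gt0)// ler_wpM2r// lerXn2r ?nnegrE ?mulr_ge0//.
have -> : (3 * x) ^+ n * ((n%:R * x) ^+ m.+1 * A * delta) =
    3 ^+ n * n%:R ^+ m.+1 * A * (x ^+ (n + m.+1) * delta).
  by rewrite !exprMn exprD; ring.
by rewrite ler_wpM2l// !mulr_ge0 ?exprn_ge0.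
Qed.

Lemma tangent_dist_le (R : realType) n K (j : {ffun 'I_n -> 'I_K.+2}) (w : 'rV[R]_n)
    (p p' : tangent R n) :
  tangent_dist p p' <= grid_disp j (lift p.1) + grid_disp j (lift p'.1) +
    (velocity_dev w p + velocity_dev w p').
Proof.
have a_ge0 := torus_dist_ge0 p.1 p'.1; have b_ge0 := enorm_ge0 (p.2 - p'.2).
apply: (@le_trans _ _ (torus_dist p.1 p'.1 + enorm (p.2 - p'.2))).
  rewrite /tangent_dist -[leRHS]ger0_norm ?addr_ge0// -sqrtr_sqr ler_sqrt ?sqr_ge0//.
  by rewrite sqrrD -addrA (addrC (_ *+ 2)) addrA lerDl mulrn_wge0// mulr_ge0.
apply: lerD; first exact: torus_dist_le_disp.
apply: le_trans (enorm_le_l1 _) _; rewrite -big_split/=; apply: ler_sum => i _.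
rewrite !mxE (_ : p.2 0 i - p'.2 0 i = (p.2 0 i - w 0 i) - (p'.2 0 i - w 0 i)); last by ring.
exact: ler_normB.
Qed.

Lemma measurable_lift (R : realType) n (f : 'rV[R]_n -> R) :
  continuous f -> periodic_fun f ->
  measurable_fun setT (fun x : borel (torus R n) => f (lift x)).
Proof.
move=> cf fp; apply: (@continuous_measurable_borel (torus R n)).
exact: continuous_lift.
Qed.

Lemma projected_wave_mean (R : realType) n (M : borel_probability (tangent R n) R)
    (m : borel_probability (torus R n) R) (k : 'rV[int]_n) (c : R) :
  (forall A : set (borel (torus R n)), measurable A ->
     m A = pushforward M (fst : borel (tangent R n) -> borel (torus R n)) A) ->
  \int[m]_x wave k c (lift x) = \int[M]_p wave k c (lift p.1).
Proof.
move=> mM.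
have mfst : measurable_fun setT (fst : borel (tangent R n) -> borel (torus R n)).
  by apply: (@continuous_measurable_borel2 (tangent R n) (torus R n)) => p; exact: cvg_fst.
pose F : {mfun borel (tangent R n) >-> borel (torus R n)} :=
  HB.pack (fst : borel (tangent R n) -> borel (torus R n))
    (isMeasurableFun.Build _ _ _ _ (fst : borel (tangent R n) -> borel (torus R n)) mfst).
rewrite /Rintegral; congr fine.
rewrite (@eq_measure_integral _ _ _ _ (distribution M F)); last by move=> A mA _; exact: mM.
rewrite integral_distribution//.
- apply/measurable_EFinP; apply: measurable_lift; [exact: continuous_wave|exact: periodic_wave].
- apply: (@probability_bounded_integrable _ _ _ M (fun p => wave k c (lift p.1)) 1).
    by apply: measurable_lift_fst; [exact: continuous_wave|exact: periodic_wave].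
  by move=> p; exact: cos_max.
Qed.

Unset Implicit Arguments.

Theorem theorem3p3 (R : realType) (n : nat) (n_gt0 : (0 < n)%N)
    (w : 'rV[R]_n) (w_nonres : nonresonant w)
    (w_cond : (exists s t : R, [/\ 0 < s, n%:R - 1 <= t & diophantine s t w])
              \/ (forall i : 'I_n, algebraic_real (w 0 i))) :
  exists l C : R, [/\ 0 < l, l < 1, 0 < C &
    forall V : R -> torus R n -> 'rV[R]_n,
      (forall delta : R, 0 <= delta -> lipschitz_field (V delta)) ->
      (forall x, V 0 x = w) ->
      (exists2 delta0 : R, 0 < delta0 & forall delta : R, 0 <= delta < delta0 ->
         (ereal_sup [set (enorm (V delta x - w))%:E | x in [set: torus R n]]
          <= delta%:E)%E) ->
      exists2 delta1 : R, 0 < delta1 & forall delta : R, 0 < delta < delta1 ->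
        (forall m0 m : borel_probability (torus R n) R,
           projected_mather_measure (lagrangian (V 0)) m0 ->
           projected_mather_measure (lagrangian (V delta)) m ->
           (wasserstein1 m0 m (@torus_dist R n) <= (C * delta `^ l)%:E)%E) /\
        (forall M0 M : borel_probability (tangent R n) R,
           mather_measure (lagrangian (V 0)) M0 ->
           mather_measure (lagrangian (V delta)) M ->
           (wasserstein1 M0 M (@tangent_dist R n) <= (C * delta `^ l)%:E)%E)].
Proof.
have [s [m [s_gt0 dioph]]] := diophantine_nat w_nonres w_cond.
pose A : R := n%:R * (n%:R + 1) / s.
have n_pos : 0 < n%:R :> R by rewrite ltr0n.
have A_gt0 : 0 < A by rewrite divr_gt0// mulr_gt0// addr_gt0.
pose B : R := 3 ^+ n * n%:R ^+ m.+1 * A.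
have B_gt0 : 0 < B by rewrite (mulr_gt0 _ A_gt0)// mulr_gt0// exprn_gt0.
(* The three terms come from the width of the bumps, the mismatch of their
   masses, and the deviation of the velocity. *)
pose C : R := 2 * n%:R + 2 * n%:R * B + n%:R * (n%:R + 1).
have n2_gt0 : 0 < 2 * n%:R :> R by rewrite mulr_gt0.
have nn_gt0 : 0 < n%:R * (n%:R + 1) :> R by rewrite mulr_gt0// addr_gt0.
have C_gt0 : 0 < C by rewrite addr_gt0// addr_gt0// mulr_gt0.
pose l : R := (2 * (n + m + 2)%:R)^-1.
have D_ge2 : 2 <= (n + m + 2)%:R :> R by rewrite ler_nat leq_addl.
exists l, C; split=> //.
- by rewrite invr_gt0 mulr_gt0// (lt_le_trans _ D_ge2).
- rewrite invf_lt1 ?mulr_gt0 ?(lt_le_trans _ D_ge2)//.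
  by apply: lt_le_trans (_ : 2 * 2 <= _); rewrite ?ler_wpM2l// -natrM ltr1n.
move=> V VL V0 [delta0 delta0_gt0 Vsup].
exists (Num.min delta0 1) => [|delta]; first by rewrite lt_min delta0_gt0 ltr01.
rewrite lt_min => /and3P[d_gt0 d_lt0 d_lt1].
have d_ge0 := ltW d_gt0.
have Vw x : enorm (V delta x - w) <= delta.
  rewrite -lee_fin; apply: le_trans (Vsup delta _); last by rewrite d_ge0.
  by apply: ereal_sup_ubound; exists x.
have V0w x : enorm (V 0 x - w) <= 0.
  rewrite V0 subrr /enorm /dotp big1 ?sqrtr0// => i _.
  by rewrite mxE mul0r.
have [K [mesh_le d_le scale_le]] := scale_choice n m d_gt0 d_lt1 (ltW A_gt0).
move: (delta `^ _) mesh_le d_le scale_le => y mesh_le d_le scale_le.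
pose E := (n * K)%:R ^+ m.+1 * A * delta.
have E_ge0 : 0 <= E.
  exact: mulr_ge0 (mulr_ge0 (exprn_ge0 _ (ler0n _ _)) (ltW A_gt0)) d_ge0.
have wave0 (M0 : borel_probability (tangent R n) R) (k : 'rV[int]_n) c :
    mather_measure (lagrangian (V 0)) M0 -> k != 0 ->
    \sum_i `|k 0 i| <= (n * K)%:Z -> \int[M0]_p wave k c (lift p.1) = 0.
  move=> MM k0 kle; apply/eqP; rewrite -normr_le0.
  have := mather_wave_mean n_gt0 c s_gt0 dioph (VL 0 (lexx _)) (lexx _) V0w MM k0 kle.
  by rewrite mulr0.
have wave_le (M : borel_probability (tangent R n) R) (k : 'rV[int]_n) c :
    mather_measure (lagrangian (V delta)) M -> k != 0 ->
    \sum_i `|k 0 i| <= (n * K)%:Z -> `|\int[M]_p wave k c (lift p.1)| <= E.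
  move=> MM k0 kle.
  have := mather_wave_mean n_gt0 c s_gt0 dioph (VL delta d_ge0) d_ge0 Vw MM k0 kle.
  by rewrite /E /A !mulrA.
have total : 2 * (n%:R * grid_mesh K) + 2 * n%:R * (K.+2%:R ^+ n * E) +
    n%:R * (n%:R + 1) * delta <= C * y.
  have -> : C * y = 2 * n%:R * y + 2 * n%:R * (B * y) + n%:R * (n%:R + 1) * y.
    by rewrite /C; ring.
  apply: lerD; first apply: lerD.
  - by rewrite mulrA ler_wpM2l// ltW.
  - by rewrite ler_wpM2l// ltW.
  - by rewrite ler_wpM2l// ltW.
split=> [m0 m1 [M0 MM0 m0E] [M1 MM1 m1E]|M0 M1 MM0 MM1].
- have := @wasserstein1_wave_le _ (borel (torus R n)) R n K m0 m1 (@lift R n)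
    (@torus_dist R n) (fun=> 0) E E_ge0.
  move=> W; apply: le_trans (W _ _ _ _ _ _ _ _ _) _ => //; clear W.
  + by move=> k c; apply: measurable_lift; [exact: continuous_wave|exact: periodic_wave].
  + by move=> j; apply: measurable_lift; [exact: continuous_grid_bump|exact: periodic_grid_bump].
  + by move=> j; apply: measurable_lift; [exact: continuous_grid_disp|exact: periodic_grid_disp].
  + by move=> k c k0 kle; rewrite (projected_wave_mean k c m0E) wave0.
  + by move=> k c k0 kle; rewrite (projected_wave_mean k c m1E) wave_le.
  + exact: torus_dist_ge0.
  + by move=> j x x'; rewrite !addr0; exact: torus_dist_le_disp.
  rewrite !integral0 !adde0 lee_fin; apply: le_trans total.
  by rewrite lerDl mulr_ge0// ltW.
- have := @wasserstein1_wave_le _ (borel (tangent R n)) R n K M0 M1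
    (fun p => lift p.1) (@tangent_dist R n) (velocity_dev w) E E_ge0.
  move=> W; apply: le_trans (W _ _ _ _ _ _ _ _ _) _ => //; clear W.
  + by move=> k c; apply: measurable_lift_fst; [exact: continuous_wave|exact: periodic_wave].
  + by move=> j; apply: measurable_lift_fst; [exact: continuous_grid_bump|exact: periodic_grid_bump].
  + by move=> j; apply: measurable_lift_fst; [exact: continuous_grid_disp|exact: periodic_grid_disp].
  + by move=> k c; exact: wave0.
  + by move=> k c; exact: wave_le.
  + exact: measurable_velocity_dev.
  + exact: velocity_dev_ge0.
  + by move=> p p'; exact: sqrtr_ge0.
  + by move=> j p p'; exact: tangent_dist_le.
  apply: le_trans (leeD (lexx _) (leeD
    (mather_velocity_dev n_gt0 (VL 0 (lexx _)) (lexx _) V0w MM0)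
    (mather_velocity_dev n_gt0 (VL delta d_ge0) d_ge0 Vw MM1))) _.
  by rewrite mulr0 add0e -EFinD lee_fin.
Qed.
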